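(* Let $\tau>0$. (a) $\mathcal B_{c,\tau}$ with norm $\|\cdot\|_{\tau,\infty}$ is a Banach space isometrically isomorphic to $\mathcal B_c$ (with norm $\|G\|'_\infty=\sup_{x<y}|G(x)-G(y)|$). (b) $\mathcal A_{c,\tau}$ with norm $\|\cdot\|_\tau$ is a Banach space isometrically isomorphic to $\mathcal A_c$ (with the Alexiewicz norm). (c) A distribution $f$ belongs to $\mathcal A_{c,\tau}$ if and only if $f\omega_\tau\in\mathcal A_c$. (d) If $f\in\mathcal A_{c,\tau}$ then $\|f\|_\tau=\|f\omega_\tau\|$. (e) For each $\tau>0$, $\mathcal A_c\subsetneq\mathcal A_{c,\tau}$. (f) For $r,s>0$: $0<r<s$ if and only if $\mathcal A_{c,s}\subsetneq\mathcal A_{c,r}$. (g) If $f\in\mathcal A_{c,\tau}$ and $F(x)=\int_0^xf$, then $|F(x)|\le\|f\|_\tau e^{x^2/(4\tau)}$ for all $x\in\mathbb R$, and $F(x)=o(e^{x^2/(4\tau)})$ as $|x|\to\infty$. (h) If $0<r<s$ then $\mathcal A_{c,s}$ is a dense subspace of $\mathcal A_{c,r}$ (with respect to $\|\cdot\|_r$). (i) If $0<r<s$ then $\|f\|_r\le2\|f\|_s$ for each $f\in\mathcal A_{c,s}$. (j) Let $L^1(\omega_\tau)=\{f\in L^1_{loc}(\mathbb R): f\omega_\tau\in L^1(\mathbb R)\}$. Then $L^1(\omega_\tau)$ is dense in $\mathcal A_{c,\tau}$. (k) $\mathcal A_{c,\tau}$ is not closed under translation.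
   Context: Let $\mathcal B_c$ be the set of continuous $G:\mathbb R\to\mathbb R$ such that $\lim_{x\to\pm\infty}G(x)$ exist as real numbers and $\lim_{x\to-\infty}G(x)=0$, normed by $\|G\|'_\infty=\sup_{x<y}|G(x)-G(y)|$. Let $\mathcal A_c$ be the distributions $g=G'$ with $G\in\mathcal B_c$ (unique primitive), integral $\int_a^bg=G(b)-G(a)$, Alexiewicz norm $\|g\|=\sup_{x<y}|G(y)-G(x)|$. For $\tau>0$ let $\omega_\tau(x)=e^{-x^2/(4\tau)}$. For $G\in\mathcal B_c$ let $F_\tau$ be the unique continuous solution of the Volterra equation $G(x)-G(0)=F_\tau(x)\omega_\tau(x)+\frac1{2\tau}\int_0^xF_\tau(\xi)\xi\,\omega_\tau(\xi)\,d\xi$ (so $F_\tau(0)=0$; $G\leftrightarrow F_\tau$ is a bijection). Let $\mathcal B_{c,\tau}$ be the set of all such $F_\tau$ (as $G$ ranges over $\mathcal B_c$), with $\|F_\tau\|_{\tau,\infty}=\|G\|'_\infty$. Let $\mathcal A_{c,\tau}$ be the distributions $f=F_\tau'$ (distributional derivative) with $F_\tau\in\mathcal B_{c,\tau}$; the primitive $F_\tau$ is unique, and $\|f\|_\tau:=\|F_\tau\|_{\tau,\infty}$; for such $f$, $\int_a^bf=F_\tau(b)-F_\tau(a)$ for real $a,b$. The product $f\omega_\tau$ is the usual product of a distribution with a smooth function. Translation of a distribution $f$ by $a$ is $f(\cdot-a)$. *)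

(* Defs.v *)
From HB Require Import structures.
From mathcomp Require Import all_boot all_order all_algebra.
From mathcomp Require Import all_classical all_reals all_analysis.
Set Implicit Arguments.
Unset Strict Implicit.
Unset Printing Implicit Defensive.
Import Order.TTheory GRing.Theory Num.Theory.
Import numFieldNormedType.Exports.
Local Open Scope classical_set_scope.
Local Open Scope ring_scope.

Section Defs.
Variable R : realType.

Local Notation mu := (@lebesgue_measure R).

Definition oint (a b : R) (f : R -> R) : R :=
  if a <= b then \int[mu]_(x in `[a, b]) f x
  else - \int[mu]_(x in `[b, a]) f x.

Definition normB (G : R -> R) : R :=
  sup [set r : R | exists x y : R, x < y /\ r = `|G x - G y|].

Definition Bc (G : R -> R) : Prop :=
  continuous G /\ cvg (G x @[x --> +oo]) /\ G x @[x --> -oo] --> 0.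

Definition omega (tau : R) (x : R) : R := expR (- (x ^+ 2) / (4 * tau)).

Definition volt (tau : R) (F : R -> R) (x : R) : R :=
  F x * omega tau x + (2 * tau)^-1 * oint 0 x (fun xi => F xi * xi * omega tau xi).

Definition volterra (tau : R) (G F : R -> R) : Prop :=
  forall x, G x - G 0 = volt tau F x.

Definition Bctau (tau : R) (F : R -> R) : Prop :=
  exists G, Bc G /\ continuous F /\ volterra tau G F.

(* ||F||_{tau,oo} := ||G||'_oo ; since G = volt tau F + G(0),
   sup_{x<y}|G x - G y| only depends on volt tau F *)
Definition normBtau (tau : R) (F : R -> R) : R := normB (volt tau F).

Definition test_fun (phi : R -> R) : Prop :=
  (forall (n : nat) (x : R), derivable (derive1n n phi) x 1) /\
  exists a b : R, forall x, phi x != 0 -> a <= x <= b.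

(* a distribution is represented by a functional on R -> R; only its values
   on test functions matter *)
Definition is_distr (T : (R -> R) -> R) : Prop :=
  (forall (a : R) phi psi, test_fun phi -> test_fun psi ->
      T (fun x => phi x + a * psi x) = T phi + a * T psi) /\
  (forall a b : R, exists (C : R) (N : nat), forall phi, test_fun phi ->
      (forall x, phi x != 0 -> a <= x <= b) ->
      `|T phi| <= C * \sum_(k < N.+1) sup [set `|derive1n k phi x| | x in [set: R]]).

Definition distr_eq (T1 T2 : (R -> R) -> R) : Prop :=
  forall phi, test_fun phi -> T1 phi = T2 phi.

Definition distr_zero : (R -> R) -> R := fun _ => 0.
Definition distr_add (T1 T2 : (R -> R) -> R) : (R -> R) -> R := fun phi => T1 phi + T2 phi.
Definition distr_scale (c : R) (T : (R -> R) -> R) : (R -> R) -> R := fun phi => c * T phi.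

Definition distr_mulw (T : (R -> R) -> R) (w : R -> R) : (R -> R) -> R :=
  fun phi => T (fun x => w x * phi x).

(* translation f(. - a) *)
Definition distr_trans (T : (R -> R) -> R) (a : R) : (R -> R) -> R :=
  fun phi => T (fun x => phi (x + a)).

Definition distr_of_fun (f : R -> R) : (R -> R) -> R :=
  fun phi => \int[mu]_x (f x * phi x).

Definition is_primitive (T : (R -> R) -> R) (F : R -> R) : Prop :=
  forall phi, test_fun phi -> T phi = - \int[mu]_x (F x * derive1 phi x).

(* A_c and its Alexiewicz norm (via the unique primitive in B_c) *)
Definition Ac (T : (R -> R) -> R) : Prop :=
  is_distr T /\ exists G, Bc G /\ is_primitive T G.

Definition anorm (T : (R -> R) -> R) : R :=
  sup [set normB G | G in [set G | Bc G /\ is_primitive T G]].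

(* A_{c,tau} and its norm (via the unique primitive in B_{c,tau}) *)
Definition Actau (tau : R) (T : (R -> R) -> R) : Prop :=
  is_distr T /\ exists F, Bctau tau F /\ is_primitive T F.

Definition tnorm (tau : R) (T : (R -> R) -> R) : R :=
  sup [set normBtau tau F | F in [set F | Bctau tau F /\ is_primitive T F]].

Definition L1w (tau : R) (f : R -> R) : Prop :=
  locally_integrable [set: R] f /\
  mu.-integrable [set: R] (EFin \o (fun x => f x * omega tau x)).

Definition banach_space (X : Type) (eqv : X -> X -> Prop) (zero : X)
  (add : X -> X -> X) (scal : R -> X -> X) (S : X -> Prop) (N : X -> R) : Prop :=
  S zero /\
      (forall x y, S x -> S y -> S (add x y)) /\
      (forall a x, S x -> S (scal a x)) /\
      (forall x, S x -> 0 <= N x /\ (N x = 0 <-> eqv x zero)) /\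
      (forall a x, S x -> N (scal a x) = `|a| * N x) /\
      (forall x y, S x -> S y -> N (add x y) <= N x + N y) /\
      (forall u : nat -> X, (forall n, S (u n)) ->
         (forall e : R, 0 < e -> exists M : nat, forall m n, (M <= m)%N -> (M <= n)%N ->
             N (add (u m) (scal (-1) (u n))) < e) ->
         exists x, S x /\ (forall e : R, 0 < e -> exists M : nat, forall n, (M <= n)%N ->
             N (add (u n) (scal (-1) x)) < e)).

Definition isometrically_isomorphic (X Y : Type)
  (eqvX : X -> X -> Prop) (addX : X -> X -> X) (scalX : R -> X -> X) (S1 : X -> Prop) (N1 : X -> R)
  (eqvY : Y -> Y -> Prop) (addY : Y -> Y -> Y) (scalY : R -> Y -> Y) (S2 : Y -> Prop) (N2 : Y -> R) : Prop :=
  exists J : X -> Y,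
  (forall x, S1 x -> S2 (J x)) /\
      (forall x x', S1 x -> eqvX x x' -> eqvY (J x) (J x')) /\
      (forall x x', S1 x -> S1 x' -> eqvY (J (addX x x')) (addY (J x) (J x'))) /\
      (forall a x, S1 x -> eqvY (J (scalX a x)) (scalY a (J x))) /\
      (forall x x', S1 x -> S1 x' -> eqvY (J x) (J x') -> eqvX x x') /\
      (forall y, S2 y -> exists x, S1 x /\ eqvY (J x) y) /\
      (forall x, S1 x -> N2 (J x) = N1 x).

Definition fadd (f g : R -> R) : R -> R := fun x => f x + g x.
Definition fscale (c : R) (f : R -> R) : R -> R := fun x => c * f x.

End Defs.

(* Main.v *)
Require Import Defs.
From HB Require Import structures.
From mathcomp Require Import all_boot all_order all_algebra.
From mathcomp Require Import ring lra.
From mathcomp Require Import all_classical all_reals all_analysis measurable_realfun.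
Set Implicit Arguments.
Unset Strict Implicit.
Unset Printing Implicit Defensive.
Import Order.TTheory GRing.Theory Num.Theory.
Import numFieldNormedType.Exports.
Local Open Scope classical_set_scope.
Local Open Scope ring_scope.

(* Integrating by parts, the Volterra equation says [dG = omega_tau dF].  Hence
   everything is governed by the operators [F |-> F(0) w(0) + \int_0^x w dF]
   ([stieltjes w]), which compose like the multiplication of the weights [w]; for
   Gaussian weights [exp (c x^2)] they form a one-parameter group ([gstieltjes c]),
   and [F] is recovered from [G] by the weight [1 / omega_tau].  On distributions the
   operator with weight [w] is multiplication of [F'] by [w].  Completeness is that of
   uniform limits; the comparisons between different [tau], the growth bound and the
   factor 2 are second mean value estimates on each half-line; primitives are unique
   by du Bois-Reymond; density is obtained by making [G] constant near infinity
   and averaging. *)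

(** * Calculus with oriented integrals *)

(** A function [F] in [Bctau] is merely continuous and may have infinite variation on every
    interval, so [dF] cannot be handled as a measure. Integration by parts moves the differential
    onto the smooth weight, and most identities are then checked by differentiating both sides,
    where [F] occurs only as a continuous factor. The normalisations disagree: [Bc] is anchored at
    minus infinity, [Bctau] at 0. Neither the norm nor the existence of limits sees additive
    constants, so the work is done with the Cauchy-type condition [has_limits] and with primitives
    vanishing at 0; the shift to [Bc] happens only at the interface. The sign of the exponent
    decides the estimates. For [c <= 0] the Gaussian weight is at most 1 and decreases away from 0,
    so limits survive; for [c > 0] only a growth bound remains. Passing from [s] to [r < s] applies
    the exponent [rate s - rate r < 0], and [Ac] corresponds to exponent 0, so (e), (f) and (i)
    share one mechanism. Density must go the opposite way, which is harmless for functions that are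
    constant near infinity. *)

Section Calculus.
Variable R : realType.
Local Notation mu := (@lebesgue_measure R).
Implicit Types (f g h P Q F G w dw : R -> R) (a b c x y : R).

Lemma is_derive_pD f g x a b : is_derive x 1 f a -> is_derive x 1 g b ->
  is_derive x 1 (fun y => f y + g y) (a + b).
Proof. by move=> ? ?; exact: is_deriveD. Qed.

Lemma is_derive_pB f g x a b : is_derive x 1 f a -> is_derive x 1 g b ->
  is_derive x 1 (fun y => f y - g y) (a - b).
Proof. by move=> ? ?; exact: is_deriveB. Qed.

Lemma is_derive_pN f x a : is_derive x 1 f a ->
  is_derive x 1 (fun y => - f y) (- a).
Proof. by move=> ?; exact: is_deriveN. Qed.

Lemma is_derive_pM f g x a b : is_derive x 1 f a -> is_derive x 1 g b ->
  is_derive x 1 (fun y => f y * g y) (a * g x + f x * b).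
Proof.
move=> fa gb; apply: (is_derive_eq (is_deriveM fa gb)).
by rewrite addrC /GRing.scale/= (mulrC (g x)).
Qed.

Lemma is_derive_pZ f x a c : is_derive x 1 f a ->
  is_derive x 1 (fun y => c * f y) (c * a).
Proof. by move=> ?; exact: is_deriveZ. Qed.

Lemma is_derive_p1 c x : is_derive x 1 (fun=> c) 0.
Proof. exact: is_derive_cst. Qed.

Lemma is_derive_pX x : is_derive x (1 : R) (fun y => y) 1.
Proof. exact: is_derive_id. Qed.

Lemma is_derive_pcomp f g x a b : is_derive (g x) 1 f a -> is_derive x 1 g b ->
  is_derive x 1 (fun y => f (g y)) (b * a).
Proof.
move=> fa gb; apply: (is_derive_eq (@is_derive1_comp _ f g x a b fa gb)).
by rewrite mulrC.
Qed.

Lemma is_derive_pexp g x b : is_derive x 1 g b ->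
  is_derive x 1 (fun y => expR (g y)) (b * expR (g x)).
Proof. by move=> ?; apply: is_derive_pcomp; exact: is_derive_expR. Qed.

Lemma is_derive_continuous f df : (forall x, is_derive x 1 f (df x)) ->
  continuous f.
Proof.
by move=> fD x; apply/differentiable_continuous/derivable1_diffP; case: (fD x).
Qed.

(** Two antiderivatives of one function differ by a constant. Most integral identities below are
    proved this way: exhibit an antiderivative and differentiate it. *)
Lemma is_derive_increment P Q h x y : (forall x, is_derive x 1 P (h x)) ->
  (forall x, is_derive x 1 Q (h x)) -> P y - P x = Q y - Q x.
Proof.
move=> PD QD; have := @is_derive_0_is_cst R (fun x => P x - Q x) y x.
move=> /(_ _)/= E; suff : P y - Q y = P x - Q x by lra.
by apply: E => z; apply: (is_derive_eq (is_derive_pB (PD z) (QD z))); rewrite subrr.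
Qed.

Lemma continuous_itv_integrable h a b : continuous h ->
  mu.-integrable `[a, b] (EFin \o h).
Proof.
move=> ch; apply: continuous_compact_integrable; first exact: segment_compact.
exact: continuous_subspaceT.
Qed.

Lemma Rintegral_itv_split f a b c : mu.-integrable `[a, c] (EFin \o f) ->
  a <= b -> b <= c ->
  \int[mu]_(x in `[a, c]) f x = \int[mu]_(x in `[a, b]) f x + \int[mu]_(x in `[b, c]) f x.
Proof.
move=> fi ab bc.
have := @Rintegral_itvB _ f (BLeft a) (BRight c) b fi.
rewrite !bnd_simp => /(_ ab bc).
rewrite (@Rintegral_itv_obnd_cbnd _ b (BRight c) f); first lra.
by apply: integrableS fi => //; apply: subset_itv; rewrite bnd_simp.
Qed.

(** Every segment lies in a symmetric one, so the hypothesis covers all positions of 0 relative to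
    [a] and [b]. It is phrased by integrability so as to serve locally integrable functions too. *)
Lemma ointB f a b : a <= b -> (forall c, 0 <= c -> mu.-integrable `[- c, c] (EFin \o f)) ->
  oint 0 b f - oint 0 a f = \int[mu]_(x in `[a, b]) f x.
Proof.
move=> ab fi; rewrite /oint.
have J (x y : R) : mu.-integrable `[x, y] (EFin \o f).
  have := fi (`|x| + `|y|) (addr_ge0 (normr_ge0 _) (normr_ge0 _)).
  apply: integrableS => //; apply: subset_itv; rewrite bnd_simp.
    by have := ler_norm (- x); rewrite normrN; have := normr_ge0 y; lra.
  by have := ler_norm y; have := normr_ge0 x; lra.
have [a0|a0] := leP 0 a; have [b0|b0] := leP 0 b.
- by rewrite (@Rintegral_itv_split f 0 a b)//; lra.
- lra.
- by rewrite (@Rintegral_itv_split f a 0 b)//; lra.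
- by rewrite (@Rintegral_itv_split f a b 0)//; lra.
Qed.

Lemma ointB_cont h a b : a <= b -> continuous h ->
  oint 0 b h - oint 0 a h = \int[mu]_(x in `[a, b]) h x.
Proof. by move=> ab ch; apply: ointB => // c _; exact: continuous_itv_integrable. Qed.

Lemma oint0 f : oint 0 0 f = 0.
Proof. by rewrite /oint lexx set_itv1 Rintegral_set1. Qed.

Lemma is_derive_oint h x : continuous h -> is_derive x 1 (fun y => oint 0 y h) (h x).
Proof.
move=> ch.
have x1 : x < x + 1 by lra.
have [dI dIE] := @continuous_FTC1_closed R h (x - 1) x (x + 1) x1
  (continuous_itv_integrable _ _ ch) ltac:(lra) (ch x).
(* Near [x] the integral from [x - 1] differs from [oint 0 y h] by a constant. With this base point
   [x] is interior whatever its sign, and no case split at 0 arises. *)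
have D : is_derive x 1 (fun y => \int[mu]_(t in [set` `[x - 1, y]]) h t + oint 0 (x - 1) h)
    (h x).
  rewrite -[X in is_derive _ _ _ X]addr0.
  apply: (is_derive_pD _ (is_derive_p1 _ x)).
  by rewrite -dIE derive1E; exact: derivableP.
apply: near_eq_is_derive D.
near=> y; rewrite -ointB_cont//; first by rewrite subrK.
by apply: ltW; near: y; apply: lt_nbhsr; lra.
Unshelve. all: by end_near. Qed.

Lemma oint_increment h P a b : continuous h -> (forall x, is_derive x 1 P (h x)) ->
  oint 0 b h - oint 0 a h = P b - P a.
Proof.
move=> ch PD; apply: (@is_derive_increment (fun y => oint 0 y h) P h) => // x.
exact: is_derive_oint.
Qed.

Lemma oint_antideriv h P x : continuous h -> (forall x, is_derive x 1 P (h x)) ->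
  oint 0 x h = P x - P 0.
Proof. by move=> ch /(oint_increment 0 x ch); rewrite oint0 subr0. Qed.

Lemma Rintegral_antideriv h P a b : a <= b -> continuous h ->
  (forall x, is_derive x 1 P (h x)) -> \int[mu]_(x in `[a, b]) h x = P b - P a.
Proof. by move=> ab ch PD; rewrite -ointB_cont// (oint_increment _ _ ch PD). Qed.

Lemma RintegralT_supp h a b : (forall x, h x != 0 -> a <= x <= b) ->
  \int[mu]_x h x = \int[mu]_(x in `[a, b]) h x.
Proof.
move=> hab; rewrite [RHS]Rintegral_mkcond; congr Rintegral; apply/funext => x.
rewrite patchE; case: ifPn => //; rewrite notin_setE /= in_itv/= => /negP xab.
by apply/eqP; apply: contraNT xab => /hab.
Qed.

Lemma RintegralT_antideriv h P a b : a <= b -> continuous h ->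
  (forall x, h x != 0 -> a <= x <= b) -> (forall x, is_derive x 1 P (h x)) ->
  \int[mu]_x h x = P b - P a.
Proof. by move=> ab ch hab PD; rewrite (RintegralT_supp hab); exact: Rintegral_antideriv. Qed.

Lemma is_derive_le P h a b : (forall x, is_derive x 1 P (h x)) -> a <= b ->
  (forall x, a <= x -> x <= b -> 0 <= h x) -> P a <= P b.
Proof.
move=> PD ab h0; have [|c + E] := @MVT_segment R P h a b ab (fun x _ => PD x).
  exact/continuous_subspaceT/(is_derive_continuous PD).
rewrite in_itv/= => /andP[ac cb].
by rewrite -subr_ge0 E mulr_ge0 ?subr_ge0 ?h0.
Qed.

Lemma continuous_pM f g : continuous f -> continuous g ->
  continuous (fun x => f x * g x).
Proof. by move=> cf cg x; exact: cvgM (cf x) (cg x). Qed.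

Lemma continuous_pD f g : continuous f -> continuous g ->
  continuous (fun x => f x + g x).
Proof. by move=> cf cg x; exact: cvgD (cf x) (cg x). Qed.

Lemma continuous_pB f g : continuous f -> continuous g ->
  continuous (fun x => f x - g x).
Proof. by move=> cf cg x; exact: cvgB (cf x) (cg x). Qed.

Lemma continuous_pZ f c : continuous f -> continuous (fun x => c * f x).
Proof. by move=> cf; apply: continuous_pM => // x; exact: cvg_cst. Qed.

Lemma continuous_pcomp f g : continuous f -> continuous g ->
  continuous (fun x => f (g x)).
Proof. by move=> cf cg x; exact: (continuous_comp (cg x) (cf _)). Qed.

End Calculus.

(** * Weighted primitives *)

Section WeightedPrimitive.
Variable R : realType.
Local Notation mu := (@lebesgue_measure R).
Implicit Types (f g h P Q F G H w dw : R -> R) (a b c d x y K : R).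

Definition weight w dw := (forall x, is_derive x 1 w (dw x)) /\ continuous dw.

(* The Stieltjes primitive "[F(0) w(0) + \int_0^x w dF]", written by parts so that
   it makes sense for a merely continuous [F]. *)
Definition stieltjes w dw F x := F x * w x - oint 0 x (fun t => F t * dw t).

Lemma weight_cont w dw : weight w dw -> continuous w.
Proof. by case=> wD _; exact: is_derive_continuous wD. Qed.

Lemma weightM w1 dw1 w2 dw2 : weight w1 dw1 -> weight w2 dw2 ->
  weight (fun x => w1 x * w2 x) (fun x => dw1 x * w2 x + w1 x * dw2 x).
Proof.
move=> W1 W2; split=> [x|]; first exact: is_derive_pM (W1.1 x) (W2.1 x).
apply: continuous_pD; apply: continuous_pM; rewrite ?W1.2 ?W2.2 //.
- exact: W1.2.
- exact: weight_cont W2.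
- exact: weight_cont W1.
- exact: W2.2.
Qed.

Lemma continuous_oint h : continuous h -> continuous (fun x => oint 0 x h).
Proof. by move=> ch; apply: is_derive_continuous => x; exact: is_derive_oint. Qed.

Lemma ointD h g x : continuous h -> continuous g ->
  oint 0 x (fun t => h t + g t) = oint 0 x h + oint 0 x g.
Proof.
move=> ch cg; have D y := is_derive_pD (is_derive_oint y ch) (is_derive_oint y cg).
by rewrite (oint_antideriv x (continuous_pD ch cg) D) !oint0; lra.
Qed.

Lemma ointZ h c x : continuous h -> oint 0 x (fun t => c * h t) = c * oint 0 x h.
Proof.
move=> ch; have D y := is_derive_pZ c (is_derive_oint y ch).
by rewrite (oint_antideriv x (continuous_pZ (c := c) ch) D) !oint0; lra.
Qed.

Lemma stieltjes_cont w dw F : weight w dw -> continuous F ->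
  continuous (stieltjes w dw F).
Proof.
move=> W cF; apply: continuous_pB.
  exact/continuous_pM/(weight_cont W).
exact/continuous_oint/continuous_pM/W.2.
Qed.

Lemma stieltjes0 w dw F : stieltjes w dw F 0 = F 0 * w 0.
Proof. by rewrite /stieltjes oint0 subr0. Qed.

Lemma stieltjesD w dw F G x : weight w dw -> continuous F -> continuous G ->
  stieltjes w dw (fun x => F x + G x) x = stieltjes w dw F x + stieltjes w dw G x.
Proof.
move=> [_ cw] cF cG; rewrite /stieltjes.
under [X in _ - oint _ _ X]funext => t do rewrite mulrDl.
by rewrite ointD; [ring|exact: continuous_pM|exact: continuous_pM].
Qed.

Lemma stieltjesZ w dw F c x : weight w dw -> continuous F ->
  stieltjes w dw (fun x => c * F x) x = c * stieltjes w dw F x.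
Proof.
move=> [_ cw] cF; rewrite /stieltjes.
under [X in _ - oint _ _ X]funext => t do rewrite -mulrA.
by rewrite ointZ; [ring|exact: continuous_pM].
Qed.

Lemma stieltjes_cst w dw c x : weight w dw -> stieltjes w dw (fun=> c) x = c * w 0.
Proof.
move=> [wD cw]; rewrite /stieltjes ointZ// (oint_antideriv _ cw wD); ring.
Qed.

Lemma stieltjes_one F x : stieltjes (fun=> 1) (fun=> 0) F x = F x.
Proof.
rewrite /stieltjes mulr1 (_ : (fun t => F t * 0) = fun=> 0); last first.
  by apply/funext => t; rewrite mulr0.
have c0 : continuous (fun _ : R => 0 : R) by move=> y; exact: cvg_cst.
by rewrite (oint_antideriv x c0 (is_derive_p1 (0 : R))) subrr subr0.
Qed.

(** Formally [w1 (w2 dF) = (w1 w2) dF]. As [F] has no derivative, the boundary terms are matched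
    algebraically and only the integral terms are compared by differentiation. *)
Lemma stieltjes_comp w1 dw1 w2 dw2 F x : weight w1 dw1 -> weight w2 dw2 ->
  continuous F ->
  stieltjes w1 dw1 (stieltjes w2 dw2 F) x =
  stieltjes (fun x => w1 x * w2 x) (fun x => dw1 x * w2 x + w1 x * dw2 x) F x.
Proof.
move=> W1 W2 cF; rewrite /stieltjes.
have [w1D cw1] := W1; have [w2D cw2] := W2.
have c1 := weight_cont W1; have c2 := weight_cont W2.
set J := fun x => oint 0 x (fun t => F t * dw2 t).
have JD y : is_derive y 1 J (F y * dw2 y).
  by apply: (@is_derive_oint _ (fun t => F t * dw2 t)); exact: continuous_pM.
set D := fun t => F t * (dw1 t * w2 t + w1 t * dw2 t).
have cD : continuous D.
  by apply: continuous_pM => //; apply: continuous_pD; exact: continuous_pM.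
(* The product rule for [w1 J] produces both [J dw1] and [w1 F dw2]; the latter cancels against the
   second half of [D]. *)
have -> : oint 0 x (fun t => (F t * w2 t - J t) * dw1 t) = oint 0 x D - w1 x * J x.
  have cE := continuous_pM (continuous_pB (continuous_pM cF c2) (is_derive_continuous JD)) cw1.
  have ED y : is_derive y (1 : R) (fun x => oint 0 x D - w1 x * J x)
      ((F y * w2 y - J y) * dw1 y).
    apply: (is_derive_eq (is_derive_pB (is_derive_oint y cD)
      (is_derive_pM (w1D y) (JD y)))).
    by rewrite /D; ring.
  by rewrite (oint_antideriv x cE ED) /J !oint0; lra.
rewrite -/(J x); ring.
Qed.

(** A constant has zero Stieltjes increment, so [F] may be recentred at any [c] before it is
    estimated. *)
Lemma stieltjes_incr w dw F c x y : weight w dw -> continuous F ->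
  stieltjes w dw F y - stieltjes w dw F x =
  (F y - c) * w y - (F x - c) * w x
  - (oint 0 y (fun t => (F t - c) * dw t) - oint 0 x (fun t => (F t - c) * dw t)).
Proof.
move=> [wD cw] cF; rewrite /stieltjes.
have -> : (fun t => (F t - c) * dw t) = (fun t => F t * dw t + (- c) * dw t).
  by apply/funext => t; ring.
rewrite !ointD ?ointZ//; do ?[exact: continuous_pM|exact: continuous_pZ].
by rewrite !(oint_antideriv _ cw wD); ring.
Qed.

Lemma stieltjes_const w dw F x y : weight w dw -> continuous F -> x <= y ->
  (forall t, x <= t -> t <= y -> F t = F x) ->
  stieltjes w dw F y = stieltjes w dw F x.
Proof.
move=> W cF xy Fx; apply/eqP; rewrite -subr_eq0 (stieltjes_incr (F x) x y W cF).
rewrite Fx// !subrr !mul0r subrr sub0r oppr_eq0 ointB_cont//; last first.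
  by apply: continuous_pM W.2; apply: continuous_pB => // z; exact: cvg_cst.
rewrite (@eq_Rintegral _ _ _ _ _ (fun=> 0)) ?Rintegral_cst//= ?mul0r//.
by move=> t; rewrite inE/= in_itv/= => /andP[xt ty]; rewrite Fx// subrr mul0r.
Qed.

(** When [dH = h dx], the terms [H dw] cancel in the derivative of the by-parts expression and [h w]
    remains. This is how explicit examples are computed. *)
Lemma stieltjes_antideriv w dw H h P x y : weight w dw -> continuous h ->
  (forall x, is_derive x 1 H (h x)) -> (forall x, is_derive x 1 P (h x * w x)) ->
  stieltjes w dw H y - stieltjes w dw H x = P y - P x.
Proof.
move=> W ch HD PD; apply: (is_derive_increment _ _ _ PD) => z.
have cH := is_derive_continuous HD; rewrite /stieltjes.
apply: is_derive_eq.
  apply: is_derive_pB; first exact: is_derive_pM (HD z) (W.1 z).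
  exact/is_derive_oint/continuous_pM/W.2.
ring.
Qed.

(** The dominating function enters through an antiderivative [U], since [U + \int u] and
    [U - \int u] are then both nondecreasing. With [v] a multiple of [dw], the bound is a multiple
    of the total variation of a monotone [w]. *)
Lemma oint_le_weight (u v : R -> R) (U : R -> R) x y : x <= y ->
  continuous u -> (forall t, is_derive t (1 : R) U (v t)) ->
  (forall t, x <= t -> t <= y -> `|u t| <= v t) ->
  `|oint 0 y u - oint 0 x u| <= U y - U x.
Proof.
move=> xy cu UD uv; rewrite ler_norml; apply/andP; split.
- have := @is_derive_le _ (fun t => U t + oint 0 t u) (fun t => v t + u t) x y.
  move=> /(_ _ xy _)/= E; suff : U x + oint 0 x u <= U y + oint 0 y u by lra.
  apply: E => [z|z xz zy]; first by apply: is_derive_pD => //; exact: is_derive_oint.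
  by have := uv z xz zy; rewrite ler_norml => /andP[]; lra.
- have := @is_derive_le _ (fun t => U t - oint 0 t u) (fun t => v t - u t) x y.
  move=> /(_ _ xy _)/= E; suff : U x - oint 0 x u <= U y - oint 0 y u by lra.
  apply: E => [z|z xz zy]; first by apply: is_derive_pB => //; exact: is_derive_oint.
  by have := uv z xz zy; rewrite ler_norml => /andP[]; lra.
Qed.

(* Second mean value estimate: recentring [F] at the endpoint where [w] is largest
   leaves only the total variation of [w] and the other endpoint value. *)
Lemma stieltjes_osc_decr w dw F K x y : weight w dw -> continuous F -> x <= y ->
  0 <= w y -> (forall t, x <= t -> t <= y -> dw t <= 0) ->
  (forall t, x <= t -> t <= y -> `|F t - F x| <= K) ->
  `|stieltjes w dw F y - stieltjes w dw F x| <= K * w x.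
Proof.
move=> W cF xy wy w0 FK; rewrite (stieltjes_incr (F x) x y W cF).
rewrite subrr mul0r subr0.
(* The integral costs [K (w x - w y)] and the boundary term costs [K w y]; together they telescope
   to [K w x]. *)
have A : `|oint 0 y (fun t => (F t - F x) * dw t) - oint 0 x (fun t => (F t - F x) * dw t)|
    <= - K * w y - - K * w x.
  apply: (@oint_le_weight _ (fun t => - K * dw t) (fun t => - K * w t)) => //.
  - by apply: continuous_pM W.2; apply: continuous_pB => // z; exact: cvg_cst.
  - by move=> t; apply: is_derive_pZ; exact: W.1.
  - move=> t xt ty; rewrite normrM mulNr -mulrN ler_pM//; first exact: FK.
    by rewrite ler0_norm// w0.
have B : `|(F y - F x) * w y| <= K * w y.
  by rewrite normrM ler_pM// ?FK// ger0_norm.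
rewrite (le_trans (ler_normB _ _))//; lra.
Qed.

Lemma stieltjes_osc_incr w dw F K x y : weight w dw -> continuous F -> x <= y ->
  0 <= w x -> (forall t, x <= t -> t <= y -> 0 <= dw t) ->
  (forall t, x <= t -> t <= y -> `|F t - F y| <= K) ->
  `|stieltjes w dw F y - stieltjes w dw F x| <= K * w y.
Proof.
move=> W cF xy wx w0 FK; rewrite (stieltjes_incr (F y) x y W cF).
rewrite subrr mul0r sub0r -opprD normrN.
have A : `|oint 0 y (fun t => (F t - F y) * dw t) - oint 0 x (fun t => (F t - F y) * dw t)|
    <= K * w y - K * w x.
  apply: (@oint_le_weight _ (fun t => K * dw t) (fun t => K * w t)) => //.
  - by apply: continuous_pM W.2; apply: continuous_pB => // z; exact: cvg_cst.
  - by move=> t; apply: is_derive_pZ; exact: W.1.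
  - move=> t xt ty; rewrite normrM ler_pM//; first exact: FK.
    by rewrite ger0_norm// w0.
have B : `|(F x - F y) * w x| <= K * w x.
  by rewrite normrM ler_pM// ?FK// ger0_norm.
rewrite (le_trans (ler_normD _ _))//; lra.
Qed.

(** * Gaussian weights and the Volterra operator *)

Definition gauss c x := expR (c * x ^+ 2).

Definition dgauss c x := 2 * c * x * gauss c x.

Lemma gauss_gt0 c x : 0 < gauss c x.
Proof. exact: expR_gt0. Qed.

Lemma gauss0 c : gauss c 0 = 1.
Proof. by rewrite /gauss expr0n/= mulr0 expR0. Qed.

Lemma gaussD c d x : gauss c x * gauss d x = gauss (c + d) x.
Proof. by rewrite /gauss -expRD mulrDl. Qed.

Lemma gauss_weight c : weight (gauss c) (dgauss c).
Proof.
have D x : is_derive x 1 (gauss c) (dgauss c x).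
  apply: (is_derive_eq (is_derive_pexp (is_derive_pZ c
    (is_derive_pM (is_derive_pX x) (is_derive_pX x))))).
  by rewrite /dgauss /gauss; ring.
split=> //; apply: continuous_pM (is_derive_continuous D).
by apply: continuous_pZ => x; exact: cvg_id.
Qed.

Definition gstieltjes c := stieltjes (gauss c) (dgauss c).

Lemma gstieltjes_comp c d F : continuous F ->
  gstieltjes c (gstieltjes d F) = gstieltjes (c + d) F.
Proof.
move=> cF; apply/funext => x.
rewrite /gstieltjes (stieltjes_comp _ (gauss_weight c) (gauss_weight d))//.
congr stieltjes; apply/funext => t; rewrite ?gaussD//.
by rewrite /dgauss -(gaussD c d); ring.
Qed.

Lemma gstieltjes_id F : gstieltjes 0 F = F.
Proof.
apply/funext => x; rewrite -[RHS](stieltjes_one F x); congr stieltjes.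
  by apply/funext => t; rewrite /gauss mul0r expR0.
by apply/funext => t; rewrite /dgauss mulr0 !mul0r.
Qed.

Lemma gstieltjesK c F : continuous F -> gstieltjes (- c) (gstieltjes c F) = F.
Proof. by move=> cF; rewrite gstieltjes_comp// addNr gstieltjes_id. Qed.

Lemma gstieltjesNK c F : continuous F -> gstieltjes c (gstieltjes (- c) F) = F.
Proof. by move=> cF; rewrite gstieltjes_comp// addrN gstieltjes_id. Qed.

Lemma gstieltjes_cont c F : continuous F -> continuous (gstieltjes c F).
Proof. exact/stieltjes_cont/gauss_weight. Qed.

Lemma gstieltjes_at0 c F : gstieltjes c F 0 = F 0.
Proof. by rewrite /gstieltjes stieltjes0 gauss0 mulr1. Qed.

Lemma omegaE tau : omega tau = gauss (- (4 * tau)^-1).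
Proof. by apply/funext => x; rewrite /omega /gauss mulNr mulrC mulNr. Qed.

(** The Volterra kernel [xi omega / (2 tau)] is minus the derivative of [omega], so the right-hand
    side of the equation is already the by-parts form of the integral of [omega dF], up to the value
    at 0. *)
Lemma voltE tau F : 0 < tau -> continuous F -> volt tau F = gstieltjes (- (4 * tau)^-1) F.
Proof.
move=> tau0 cF; apply/funext => x; rewrite /volt /gstieltjes /stieltjes omegaE.
congr (_ + _); set k := - (4 * tau)^-1.
have -> : (fun t => F t * dgauss k t) = (fun t => (2 * k) * (F t * t * gauss k t)).
  by apply/funext => t; rewrite /dgauss; ring.
rewrite ointZ; first by rewrite /k; field; rewrite gt_eqF.
apply: continuous_pM (weight_cont (gauss_weight k)).
by apply: continuous_pM => // y; exact: cvg_id.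
Qed.

End WeightedPrimitive.

(** * Functions with limits at infinity *)

Section LimitsAtInfinity.
Variable R : realType.
Local Notation mu := (@lebesgue_measure R).
Implicit Types (f g h P Q F G H w dw : R -> R) (a b c d e x y K M : R).

Lemma continuous_epsP G : continuous G <-> forall x e, 0 < e ->
  exists2 d, 0 < d & forall y, `|x - y| < d -> `|G x - G y| <= e.
Proof.
split=> [cG x e e0|H x].
  have /cvgrPdist_le/(_ e e0)/nbhs_ballP[d /= d0 Hd] := cG x.
  by exists d => // y xy; exact: Hd.
apply/cvgrPdist_le => e e0; have [d d0 Hd] := H x e e0.
by apply/nbhs_ballP; exists d => //= y /=; exact: Hd.
Qed.

Lemma cvg_pinftyP G : cvg (G x @[x --> +oo]) <-> forall e, 0 < e ->
  exists M, forall x y, M <= x -> M <= y -> `|G x - G y| <= e.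
Proof.
split=> [/cvg_ex[l /cvgrPdist_le H] e e0|H].
  have [|M [_ HM]] := H (e / 2); first lra.
  (* The neighbourhood of infinity is given by the strict inequality [M < x]; the shift by 1 makes
     it non-strict. *)
  exists (M + 1) => x y Mx My; rewrite (le_trans (ler_distD l _ _))//.
  rewrite (distrC (G x)).
  have := HM x; have := HM y; move=> /(_ ltac:(lra))/= + /(_ ltac:(lra))/=; lra.
apply/cauchy_cvgP; apply: cauchy_exP => e e0.
have [|M HM] := H (e / 2); first lra.
exists (G M); exists M; split; first exact: num_real.
move=> x Mx /=; rewrite /ball/= (le_lt_trans (HM M x _ _))//; last lra.
exact: ltW.
Qed.

Lemma cvg_ninftyP G : cvg (G x @[x --> -oo]) <-> forall e, 0 < e ->
  exists M, forall x y, x <= M -> y <= M -> `|G x - G y| <= e.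
Proof.
split=> [/cvg_ex[l /cvgrPdist_le H] e e0|H].
  have [|M [_ HM]] := H (e / 2); first lra.
  exists (M - 1) => x y Mx My; rewrite (le_trans (ler_distD l _ _))//.
  rewrite (distrC (G x)).
  have := HM x; have := HM y; move=> /(_ ltac:(lra))/= + /(_ ltac:(lra))/=; lra.
apply/cauchy_cvgP; apply: cauchy_exP => e e0.
have [|M HM] := H (e / 2); first lra.
exists (G M); exists M; split; first exact: num_real.
move=> x Mx /=; rewrite /ball/= (le_lt_trans (HM M x _ _))//; last lra.
exact: ltW.
Qed.

(** Cauchy's condition at both ends, which never names a limit and is blind to additive constants.
    Requiring [0 <= M] keeps each tail within one half-line, where Gaussian weights are monotone. *)
Definition osc_vanishes G := forall e, 0 < e -> exists2 M, 0 <= M &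
  (forall x y, M <= x -> M <= y -> `|G x - G y| <= e) /\
  (forall x y, x <= - M -> y <= - M -> `|G x - G y| <= e).

Definition has_limits G := continuous G /\ osc_vanishes G.

Lemma osc_vanishesP G : osc_vanishes G <->
  cvg (G x @[x --> +oo]) /\ cvg (G x @[x --> -oo]).
Proof.
rewrite cvg_pinftyP cvg_ninftyP; split=> [H|[H1 H2] e e0].
  by split=> e /H[M _ [H1 H2]]; [exists M|exists (- M)].
have [M1 H1M] := H1 e e0; have [M2 H2M] := H2 e e0.
have M1p := ler_norm M1; have M2p := ler_norm (- M2); rewrite normrN in M2p.
have n1 := normr_ge0 M1; have n2 := normr_ge0 M2.
exists (`|M1| + `|M2|); first lra.
by split=> x y Mx My; [apply: H1M|apply: H2M]; lra.
Qed.

Lemma has_limits_flat G M : 0 <= M -> continuous G ->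
  (forall x, M <= x -> G x = G M) -> (forall x, x <= - M -> G x = G (- M)) ->
  has_limits G.
Proof.
move=> M0 cG G1 G2; split=> // e e0; exists M => //; split=> x y Mx My.
  by rewrite !G1// subrr normr0 ltW.
by rewrite (G2 x)// (G2 y)// subrr normr0 ltW.
Qed.

Lemma has_limitsD F G : has_limits F -> has_limits G -> has_limits (fun x => F x + G x).
Proof.
move=> [cF oF] [cG oG]; split; first exact: continuous_pD.
move: oF oG; rewrite !osc_vanishesP => -[F1 F2] [G1 G2].
by split; apply: is_cvgD.
Qed.

Lemma has_limitsZ F c : has_limits F -> has_limits (fun x => c * F x).
Proof.
move=> [cF oF]; split; first exact: continuous_pZ.
move: oF; rewrite !osc_vanishesP => -[F1 F2].
by split; apply: is_cvgMr.
Qed.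

Lemma has_limits_cst c : has_limits (fun=> c).
Proof.
split; first by move=> x; exact: cvg_cst.
by move=> e e0; exists 0 => //; split=> *; rewrite subrr normr0 ltW.
Qed.

Lemma has_limitsB F G : has_limits F -> has_limits G -> has_limits (fun x => F x - G x).
Proof.
move=> cF /(@has_limitsZ _ (-1)) cG.
rewrite (_ : (fun x => _) = fun x => F x + -1 * G x); first exact: has_limitsD.
by apply/funext => x; rewrite mulN1r.
Qed.

Lemma has_limits_bounded G : has_limits G ->
  exists2 K, 0 <= K & forall x, `|G x| <= K.
Proof.
move=> [cG oG]; have [M M0 [H1 H2]] := oG 1 ltr01.
have [||c _ Hc] := @EVT_max R (fun x => `|G x|) (- M) M; first lra.
  apply: continuous_subspaceT => x; apply: continuous_comp; first exact: cG.
  exact: norm_continuous.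
have A x : - M <= x <= M -> `|G x| <= `|G c| by move=> xM; apply: Hc; rewrite in_itv.
exists (`|G c| + 1) => [|x]; first by rewrite addr_ge0.
have [Mx|xM] := leP M x.
  have := H1 x M Mx (lexx _); have := A M; have := ler_normD (G x - G M) (G M).
  by rewrite subrK => + /(_ ltac:(lra)); lra.
have [Mx'|xM'] := leP x (- M).
  have := H2 x (- M) Mx' (lexx _); have := A (- M); have := ler_normD (G x - G (- M)) (G (- M)).
  by rewrite subrK => + /(_ ltac:(lra)); lra.
by have := A x ltac:(lra); lra.
Qed.

Lemma normB_ub G x y : has_limits G -> `|G x - G y| <= normB G.
Proof.
move=> /has_limits_bounded[K K0 HK].
(* [sup] takes a default value on unbounded sets, so boundedness must be secured before the supremum
   bounds anything. *)
have ub : has_ubound [set r : R | exists x y : R, x < y /\ r = `|G x - G y|].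
  exists (K + K) => _ [u [v [_ ->]]]; rewrite (le_trans (ler_normB _ _))//.
  by rewrite lerD.
have A u v : u < v -> `|G u - G v| <= normB G by move=> uv; apply: ub_le_sup => //; exists u, v.
case: (ltgtP x y) => [/A//|/A|->]; first by rewrite distrC.
by rewrite subrr normr0 (le_trans _ (A 0 1 ltr01)).
Qed.

Lemma normB_le G K : (forall x y, x < y -> `|G x - G y| <= K) -> normB G <= K.
Proof.
move=> HK; apply: ge_sup; first by exists `|G 0 - G 1|, 0, 1.
by move=> _ [x [y [xy ->]]]; exact: HK.
Qed.

Lemma normB_ge0 G : has_limits G -> 0 <= normB G.
Proof. by move=> /(normB_ub 0 0); apply: le_trans. Qed.

Lemma normB_eq F G : (forall x y, F x - F y = G x - G y) -> normB F = normB G.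
Proof.
move=> FG; rewrite /normB; congr sup; apply/seteqP.
by split=> _ [x [y [xy ->]]]; exists x, y; rewrite FG.
Qed.

Lemma normBD F G : has_limits F -> has_limits G ->
  normB (fun x => F x + G x) <= normB F + normB G.
Proof.
move=> lF lG; apply: normB_le => x y _; rewrite opprD addrACA.
by rewrite (le_trans (ler_normD _ _))// lerD// normB_ub.
Qed.

Lemma normBZ F c : has_limits F -> normB (fun x => c * F x) = `|c| * normB F.
Proof.
move=> lF; apply/eqP; rewrite eq_le; apply/andP; split.
  by apply: normB_le => x y _; rewrite -mulrBr normrM ler_wpM2l// normB_ub.
have [->|c0] := eqVneq c 0; first by rewrite normr0 mul0r normB_ge0//; apply: has_limitsZ.
rewrite mulrC -ler_pdivlMr ?normr_gt0//; apply: normB_le => x y _.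
rewrite ler_pdivlMr ?normr_gt0// -normrM mulrC mulrBr.
exact: (@normB_ub (fun x => c * F x)) (has_limitsZ _ lF).
Qed.

Lemma normB_eq0 F : has_limits F -> normB F = 0 -> forall x y, F x = F y.
Proof.
move=> lF F0 x y; have := normB_ub x y lF.
by rewrite F0 normr_le0 subr_eq0 => /eqP.
Qed.

Lemma normB_dist_le F G K : (forall x, `|F x - G x| <= K) ->
  normB (fun x => F x - G x) <= K + K.
Proof.
move=> FG; apply: normB_le => x y _.
by rewrite (le_trans (ler_normB _ _))// lerD.
Qed.

(** Anchoring all functions at 0 turns the oscillation seminorm into a bound on the uniform norm.
    The uniform limit then inherits continuity and vanishing oscillation by a three-epsilon
    argument. *)
Lemma has_limits_complete (u : nat -> R -> R) : (forall n, has_limits (u n)) ->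
  (forall n, u n 0 = 0) ->
  (forall e, 0 < e -> exists N, forall m n, (N <= m)%N -> (N <= n)%N ->
     normB (fun x => u m x - u n x) < e) ->
  exists2 G, has_limits G /\ G 0 = 0 & forall e, 0 < e -> exists N, forall n,
    (N <= n)%N -> normB (fun x => u n x - G x) < e.
Proof.
move=> lu u0 uC.
have uC' e : 0 < e -> exists N, forall m n, (N <= m)%N -> (N <= n)%N ->
    forall x, `|u m x - u n x| <= e.
  move=> /uC[N HN]; exists N => m n Nm Nn x.
  rewrite (le_trans _ (ltW (HN m n Nm Nn)))//.
  have := @normB_ub (fun x => u m x - u n x) x 0 (has_limitsB (lu m) (lu n)).
  by rewrite !u0 subrr subr0.
pose G x := lim (u n x @[n --> \oo]).
have uG x : u n x @[n --> \oo] --> G x.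
  suff : cvg (u n x @[n --> \oo]) by [].
  apply/cauchy_cvgP; apply: cauchy_exP => e e0.
  have [|N HN] := uC' (e / 2); first lra.
  exists (u N x); exists N => // n /= Nn; rewrite /ball/=.
  by rewrite (le_lt_trans (HN N n _ _ x))//; lra.
have uG' e : 0 < e -> exists N, forall n, (N <= n)%N -> forall x, `|u n x - G x| <= e.
  move=> e0; have [|N HN] := uC' (e / 2); first lra.
  exists N => n Nn x; have e20 : 0 < e / 2 by lra.
  have /cvgrPdist_le/(_ _ e20)[N' _ HN'] := uG x.
  have := HN' (maxn N N'); rewrite /= leq_maxr => /(_ isT).
  have := HN n (maxn N N') Nn (leq_maxl _ _) x.
  have := ler_distD (u (maxn N N') x) (u n x) (G x).
  by rewrite (distrC (G x)); lra.
have G0 : G 0 = 0.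
  apply/eqP; rewrite -normr_le0; apply/ler_addgt0Pr => e e0; rewrite add0r.
  by have [N /(_ N (leqnn _) 0)] := uG' e e0; rewrite u0 sub0r normrN.
have tri n x y : `|G x - G y| <= `|u n x - G x| + `|u n x - u n y| + `|u n y - G y|.
  have -> : G x - G y = - (u n x - G x) + (u n x - u n y) + (u n y - G y) by ring.
  by rewrite (le_trans (ler_normD _ _))// lerD// (le_trans (ler_normD _ _))// normrN.
have lG : has_limits G.
  split.
    apply/continuous_epsP => x e e0; have e3 : 0 < e / 3 by lra.
    have [N HN] := uG' _ e3.
    have /continuous_epsP/(_ x _ e3)[d d0 Hd] := (lu N).1.
    exists d => // y /Hd; have := HN N (leqnn _) x; have := HN N (leqnn _) y.
    by have := tri N x y; lra.
  move=> e e0; have e3 : 0 < e / 3 by lra.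
  have [N HN] := uG' _ e3; have [M M0 [H1 H2]] := (lu N).2 _ e3.
  exists M => //; split=> x y Mx My; have := tri N x y;
    have := HN N (leqnn _) x; have := HN N (leqnn _) y.
  - by have := H1 x y Mx My; lra.
  - by have := H2 x y Mx My; lra.
exists G => // e e0; have [|N HN] := uG' (e / 3); first lra.
exists N => n Nn; rewrite (le_lt_trans (normB_dist_le (HN n Nn)))//; lra.
Qed.

(** For [c <= 0] the weight decreases away from 0, so on either half-line the bound carries its
    value at the endpoint nearer to 0, which is at most 1. *)
Lemma gstieltjes_osc_right c G K x y : c <= 0 -> continuous G -> 0 <= x -> x <= y ->
  (forall u v, x <= u -> x <= v -> `|G u - G v| <= K) ->
  `|gstieltjes c G y - gstieltjes c G x| <= K * gauss c x.
Proof.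
move=> c0 cG x0 xy GK; apply: (stieltjes_osc_decr (gauss_weight c)) => //.
- exact/ltW/gauss_gt0.
- move=> t xt _; rewrite mulr_le0_ge0//; last exact/ltW/gauss_gt0.
  by rewrite mulr_le0_ge0 ?(le_trans x0)//; lra.
- by move=> t xt _; exact: GK.
Qed.

Lemma gstieltjes_osc_left c G K x y : c <= 0 -> continuous G -> y <= 0 -> x <= y ->
  (forall u v, u <= y -> v <= y -> `|G u - G v| <= K) ->
  `|gstieltjes c G y - gstieltjes c G x| <= K * gauss c y.
Proof.
move=> c0 cG x0 xy GK; apply: (stieltjes_osc_incr (gauss_weight c)) => //.
- exact/ltW/gauss_gt0.
- move=> t _ ty; rewrite mulr_ge0//; last exact/ltW/gauss_gt0.
  by rewrite mulr_le0 ?(le_trans ty)//; lra.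
- by move=> t _ ty; exact: GK.
Qed.

Lemma gauss_le1 c x : c <= 0 -> gauss c x <= 1.
Proof. by move=> c0; rewrite /gauss -expR0 ler_expR mulr_le0_ge0// sqr_ge0. Qed.

Lemma gstieltjes_has_limits c G : c <= 0 -> has_limits G -> has_limits (gstieltjes c G).
Proof.
move=> c0 [cG oG]; split; first exact: gstieltjes_cont.
move=> e e0; have [M M0 [H1 H2]] := oG e e0; exists M => //; split.
  move=> x y; wlog xy : x y / x <= y.
    by move=> W Mx My; case: (leP x y) => [/W|/ltW/W]; last rewrite distrC; exact.
  move=> Mx My; rewrite distrC.
  have /(_ e)A := gstieltjes_osc_right c0 cG (le_trans M0 Mx) xy.
  rewrite (le_trans (A _))//; last by rewrite ger_pMr// gauss_le1.
  by move=> u v xu xv; apply: H1; exact: le_trans Mx _.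
move=> x y; wlog xy : x y / x <= y.
  by move=> W Mx My; case: (leP x y) => [/W|/ltW/W]; last rewrite distrC; exact.
move=> Mx My; rewrite distrC.
have /(_ e)A := @gstieltjes_osc_left c G _ _ _ c0 cG (le_trans My _) xy.
rewrite (le_trans (A _ _))//; [lra| |by rewrite ger_pMr// gauss_le1].
by move=> u v xu xv; apply: H2; [exact: le_trans xu _|exact: le_trans xv _].
Qed.

(** Within a half-line the weight is monotone and at most 1, which gives constant 1. An increment
    across 0 is split there into two such increments, hence the factor 2. *)
Lemma normB_gstieltjes c G : c <= 0 -> has_limits G ->
  normB (gstieltjes c G) <= 2 * normB G.
Proof.
move=> c0 lG; have cG := lG.1; have N0 := normB_ge0 lG.
have A x y : 0 <= x -> x <= y -> `|gstieltjes c G y - gstieltjes c G x| <= normB G.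
  move=> x0 xy; rewrite (le_trans (@gstieltjes_osc_right c G (normB G) x y _ _ _ _ _))//.
    by move=> u v _ _; exact: normB_ub.
  by rewrite ler_piMr// gauss_le1.
have B x y : y <= 0 -> x <= y -> `|gstieltjes c G y - gstieltjes c G x| <= normB G.
  move=> x0 xy; rewrite (le_trans (@gstieltjes_osc_left c G (normB G) x y _ _ _ _ _))//.
    by move=> u v _ _; exact: normB_ub.
  by rewrite ler_piMr// gauss_le1.
apply: normB_le => x y xy; rewrite distrC.
have [x0|x0] := leP 0 x; first by have := A x y x0 (ltW xy); lra.
have [y0|y0] := leP y 0; first by have := B x y y0 (ltW xy); lra.
rewrite (le_trans (ler_distD (gstieltjes c G 0) _ _))//.
have := A 0 y (lexx _) (ltW y0); have := B x 0 (lexx _) (ltW x0); lra.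
Qed.

(** For [c >= 0] the monotonicity is reversed: the weight is largest at the endpoint farther from 0,
    and the bound becomes one on growth. *)
Lemma gstieltjes_growth_right c G K x y : 0 <= c -> continuous G -> 0 <= x -> x <= y ->
  (forall u v, x <= u -> x <= v -> `|G u - G v| <= K) ->
  `|gstieltjes c G y - gstieltjes c G x| <= K * gauss c y.
Proof.
move=> c0 cG x0 xy GK; apply: (stieltjes_osc_incr (gauss_weight c)) => //.
- exact/ltW/gauss_gt0.
- move=> t xt _; rewrite mulr_ge0//; last exact/ltW/gauss_gt0.
  by rewrite mulr_ge0//; [lra|exact: le_trans x0 xt].
- by move=> t xt _; exact: GK.
Qed.

Lemma gstieltjes_growth_left c G K x y : 0 <= c -> continuous G -> y <= 0 -> x <= y ->
  (forall u v, u <= y -> v <= y -> `|G u - G v| <= K) ->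
  `|gstieltjes c G y - gstieltjes c G x| <= K * gauss c x.
Proof.
move=> c0 cG x0 xy GK; apply: (stieltjes_osc_decr (gauss_weight c)) => //.
- exact/ltW/gauss_gt0.
- move=> t _ ty; rewrite mulr_le0_ge0//; last exact/ltW/gauss_gt0.
  by rewrite mulr_ge0_le0 ?(le_trans ty)//; lra.
- move=> t _ ty; exact: GK.
Qed.

Lemma gstieltjes_growth c G x : 0 <= c -> has_limits G -> G 0 = 0 ->
  `|gstieltjes c G x| <= normB G * gauss c x.
Proof.
move=> c0 lG G0; have cG := lG.1.
have S0 : gstieltjes c G 0 = 0 by rewrite gstieltjes_at0.
have [x0|x0] := leP 0 x.
  rewrite -[gstieltjes c G x]subr0 -S0; apply: gstieltjes_growth_right => // u v _ _.
  exact: normB_ub.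
rewrite -normrN -sub0r -S0; apply: gstieltjes_growth_left => //; first exact: ltW.
by move=> u v _ _; exact: normB_ub.
Qed.

Lemma gauss_large c K : 0 < c -> exists2 N, 0 <= N & forall x, N <= `|x| -> K <= gauss c x.
Proof.
(* As [|x| >= 1], also [x^2 >= |x| >= |K| / c], and [exp (c x^2) >= 1 + c x^2] finishes. *)
move=> c0; exists (1 + `|K| / c); first by rewrite addr_ge0// divr_ge0// ltW.
move=> x Nx; rewrite (le_trans _ (expR_ge1Dx _))//.
have Kc : 0 <= `|K| / c by rewrite divr_ge0// ltW.
have : `|K| / c <= x ^+ 2 by rewrite -real_normK ?num_real//; nra.
rewrite ler_pdivrMr// mulrC; have := ler_norm K; lra.
Qed.

Lemma gstieltjes_littleo c G : 0 < c -> has_limits G ->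
  (gstieltjes c G x / gauss c x @[x --> +oo] --> 0) /\
  (gstieltjes c G x / gauss c x @[x --> -oo] --> 0).
Proof.
move=> c0 [cG oG].
suff A e : 0 < e -> exists2 M, 0 <= M & forall x, M <= `|x| ->
    `|0 - gstieltjes c G x / gauss c x| <= e.
  split; apply/cvgrPdist_le => e /A[M M0 HM].
    exists M; split; rewrite ?num_real// => x Mx; apply: HM.
    by rewrite (le_trans (ltW Mx))// ler_norm.
  exists (- M); split; rewrite ?num_real// => x Mx; apply: HM.
  by rewrite -normrN (le_trans _ (ler_norm _))//; lra.
move=> e0; have e2 : 0 < e / 2 by lra.
have [M M0 [H1 H2]] := oG _ e2.
(* Beyond the cut points [M] and [- M] the increment is at most [(e / 2) gauss c x]. The fixed value
   at the cut point is at most [B], and [B] is at most the same quantity once the Gaussian exceeds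
   [B / (e / 2)]. *)
pose B := `|gstieltjes c G M| + `|gstieltjes c G (- M)|.
have [N N0 HN] := @gauss_large c (B / (e / 2)) c0.
exists (M + N) => [|x Mx]; first lra.
rewrite sub0r normrN normrM normfV (gtr0_norm (gauss_gt0 _ _)) ler_pdivrMr ?gauss_gt0//.
have : B / (e / 2) <= gauss c x by apply: HN; lra.
rewrite ler_pdivrMr// => HB.
have n1 := normr_ge0 (gstieltjes c G M); have n2 := normr_ge0 (gstieltjes c G (- M)).
have [x0|x0] := leP 0 x.
  rewrite ger0_norm// in Mx; have Mx' : M <= x by lra.
  have := @gstieltjes_growth_right c G (e / 2) M x (ltW c0) cG M0 Mx'.
  move=> /(_ (fun u v uM vM => H1 u v uM vM)).
  have := ler_normD (gstieltjes c G x - gstieltjes c G M) (gstieltjes c G M).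
  by rewrite subrK /B in HB *; lra.
rewrite ltr0_norm// in Mx; have Mx' : x <= - M by lra.
have M0' : - M <= 0 by lra.
have := @gstieltjes_growth_left c G (e / 2) x (- M) (ltW c0) cG M0' Mx'.
move=> /(_ (fun u v uM vM => H2 u v uM vM)).
have := ler_normD (gstieltjes c G x - gstieltjes c G (- M)) (gstieltjes c G (- M)).
by rewrite subrK (distrC (gstieltjes c G x)) /B in HB *; lra.
Qed.

(** * Truncation: [G (clip M x)] is continuous and constant beyond [M] and [- M] *)

Definition clip M x := Num.max (- M) (Num.min x M).

Lemma clip_cont M : continuous (clip M).
Proof.
move=> x; exact: (@continuous_max R R (fun=> - M) (fun x => Num.min x M) x
  (cvg_cst _) (@continuous_min R R id (fun=> M) x cvg_id (cvg_cst _))).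
Qed.

Lemma clip_right M x : 0 <= M -> M <= x -> clip M x = M.
Proof. by move=> M0 Mx; rewrite /clip min_r// max_r//; lra. Qed.

Lemma clip_left M x : 0 <= M -> x <= - M -> clip M x = - M.
Proof. by move=> M0 Mx; rewrite /clip min_l ?max_l//; lra. Qed.

Lemma clip_mid M x : - M <= x -> x <= M -> clip M x = x.
Proof. by move=> Mx xM; rewrite /clip min_l// max_r. Qed.

Lemma clip_approx G e : has_limits G -> 0 < e ->
  exists2 M, 0 <= M & forall x, `|G x - G (clip M x)| <= e.
Proof.
move=> [_ oG] e0; have [M M0 [H1 H2]] := oG e e0; exists M => // x.
have [Mx|xM] := leP M x; first by rewrite clip_right// H1.
have [Mx'|xM'] := leP x (- M); first by rewrite clip_left// H2.
by rewrite clip_mid ?subrr ?normr0 ltW.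
Qed.

End LimitsAtInfinity.

(** * Test functions and distributional derivatives *)

Section TestFunctions.
Variable R : realType.
Local Notation mu := (@lebesgue_measure R).
Implicit Types (f g h P Q F G H w dw phi psi : R -> R) (a b c d e x y K M : R) (n k : nat).

(** The recursion peels off the innermost derivative, so closure under products and affine
    substitution follows by induction on [n] with [f] general; [derive1n] iterates from the
    outside. *)
Fixpoint diffn n f : Prop :=
  if n is n'.+1 then (forall x, derivable f x 1) /\ diffn n' (derive1 f) else True.

Lemma is_derive_derive1 f x : derivable f x 1 -> is_derive x 1 f ((derive1 f) x).
Proof. by rewrite derive1E; exact: derivableP. Qed.

Lemma is_derive_derive1E f df : (forall x, is_derive x (1 : R) f (df x)) -> (derive1 f) = df.
Proof. by move=> D; apply/funext => x; rewrite derive1E; case: (D x). Qed.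

Lemma diffn_step n f df : (forall x, is_derive x (1 : R) f (df x)) -> diffn n df -> diffn n.+1 f.
Proof. by move=> D; rewrite /= (is_derive_derive1E D); split=> // x; case: (D x). Qed.

Lemma diffnW n f : diffn n.+1 f -> diffn n f.
Proof. by elim: n f => [//|n IH] f /= [f1 [f2 f3]]; split=> //; apply: IH; split. Qed.

Lemma diffnD n f g : diffn n f -> diffn n g -> diffn n (fun x => f x + g x).
Proof.
elim: n f g => [//|n IH] f g [f1 f2] [g1 g2].
apply: (diffn_step (df := fun x => (derive1 f) x + (derive1 g) x)); last exact: IH.
by move=> x; apply: is_derive_pD; exact: is_derive_derive1.
Qed.

Lemma diffnM n f g : diffn n f -> diffn n g -> diffn n (fun x => f x * g x).
Proof.
elim: n f g => [//|n IH] f g Df Dg; have [f1 f2] := Df; have [g1 g2] := Dg.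
apply: (diffn_step (df := fun x => (derive1 f) x * g x + f x * (derive1 g) x)).
  by move=> x; apply: is_derive_pM; exact: is_derive_derive1.
by apply: diffnD; apply: IH => //; exact: diffnW.
Qed.

Lemma diffn_cst n c : diffn n (fun=> c).
Proof.
elim: n c => [//|n IH] c; exact: (diffn_step (is_derive_p1 c) (IH 0)).
Qed.

Lemma diffn_id n : diffn n (fun x => x).
Proof.
by case: n => [//|n]; exact: (diffn_step (@is_derive_pX R) (diffn_cst n 1)).
Qed.

Lemma diffn_affine n f a b : diffn n f -> diffn n (fun x => f (a * x + b)).
Proof.
elim: n f => [//|n IH] f [f1 f2].
apply: (diffn_step (df := fun x => a * (derive1 f) (a * x + b))); last first.
  by apply: diffnM; [exact: diffn_cst|exact: IH].
move=> x; apply: (@is_derive_pcomp _ f (fun x => a * x + b)).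
  exact: is_derive_derive1.
apply: (is_derive_eq (is_derive_pD (is_derive_pZ a (is_derive_pX x)) (is_derive_p1 b x))).
by rewrite mulr1 addr0.
Qed.

Lemma diffn_gauss n c : diffn n (@gauss R c).
Proof.
elim: n => [//|n IH]; apply: (diffn_step (gauss_weight c).1).
apply: diffnM => //; apply: diffnM; first exact: diffn_cst.
exact: diffn_id.
Qed.

Lemma diffn_derive1n f : (forall n, diffn n f) <->
  (forall n x, derivable (derive1n n f) x 1).
Proof.
split.
  move=> H n; have := H n.+1; elim: n f {H} => [|n IH] f; first by case.
  by move=> [_ /IH]; rewrite /derive1n iterSr.
move=> H n; elim: n f H => [//|n IH] f H; split; first exact: (H 0%N).
by apply: IH => k x; have := H k.+1 x; rewrite /derive1n iterSr.
Qed.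

Lemma test_funP phi : test_fun phi <-> (forall n, diffn n phi) /\
  exists2 M, 0 <= M & forall x, phi x != 0 -> - M <= x <= M.
Proof.
rewrite diffn_derive1n; split=> -[D H]; split=> //.
  have [a [b ab]] := H; exists (`|a| + `|b|); first by rewrite addr_ge0.
  move=> x /ab; have := ler_norm b; have := ler_norm (- a); rewrite normrN.
  by have := normr_ge0 a; have := normr_ge0 b; lra.
by have [M _ HM] := H; exists (- M), M.
Qed.

Lemma derive1_supp f a b x : (forall x, is_derive x 1 f ((derive1 f) x)) ->
  (forall x, f x != 0 -> a <= x <= b) -> (derive1 f) x != 0 -> a <= x <= b.
Proof.
move=> D fab; apply: contraNT => xab.
have f0 : \forall y \near x, f y = 0.
  have [xa|ax] := ltP x a.
    near=> y; apply/eqP; apply: contraT => /fab /andP[ay _].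
    by have : y < a by [near: y; exact: lt_nbhsl]; lra.
  have bx : b < x by move: xab; rewrite ax/= -ltNge.
  near=> y; apply/eqP; apply: contraT => /fab /andP[_ yb].
  by have : b < y by [near: y; exact: lt_nbhsr]; lra.
have : is_derive x 1 f 0.
  apply: near_eq_is_derive (is_derive_p1 (0 : R) x).
  by near=> y; rewrite (near f0 y).
by move=> D0; have := D x; case=> _ <-; case: D0 => _ ->.
Unshelve. all: by end_near. Qed.

Lemma test_fun_derive phi x : test_fun phi -> is_derive x 1 phi ((derive1 phi) x).
Proof. by case/test_funP => /(_ 1%N)[D _] _; exact: is_derive_derive1. Qed.

Lemma test_fun_cont phi : test_fun phi -> continuous phi.
Proof. by move=> T; apply: is_derive_continuous => x; exact: test_fun_derive. Qed.

Lemma test_fun_cont1 phi : test_fun phi -> continuous (derive1 phi).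
Proof.
case/test_funP => /(_ 2)[_ [D _]] _.
by apply: is_derive_continuous => x; exact: is_derive_derive1.
Qed.

Lemma test_fun_supp phi : test_fun phi -> exists2 M, 0 <= M &
  (forall x, phi x != 0 -> - M <= x <= M) /\ (forall x, (derive1 phi) x != 0 -> - M <= x <= M).
Proof.
move=> T; have /test_funP[_ [M M0 HM]] := T; exists M => //; split=> // x.
exact: (derive1_supp (fun y => test_fun_derive y T) HM).
Qed.

Lemma test_funD phi psi : test_fun phi -> test_fun psi ->
  test_fun (fun x => phi x + psi x).
Proof.
move=> /test_funP[Dp [M M0 HM]] /test_funP[Dq [N N0 HN]]; apply/test_funP; split.
  by move=> n; exact: diffnD.
exists (M + N); first lra.
move=> x; have [->|/HM] := eqVneq (phi x) 0; last lra.
by rewrite add0r => /HN; lra.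
Qed.

Lemma test_funM w phi : (forall n, diffn n w) -> test_fun phi ->
  test_fun (fun x => w x * phi x).
Proof.
move=> Dw /test_funP[Dp [M M0 HM]]; apply/test_funP; split.
  by move=> n; exact: diffnM.
exists M => // x wx; apply: HM; apply: contraNneq wx => ->.
by rewrite mulr0.
Qed.

Lemma test_fun_gauss c phi : test_fun phi -> test_fun (fun x => gauss c x * phi x).
Proof. by apply: test_funM => n; exact: diffn_gauss. Qed.

Lemma RintegralT_oint h M : 0 <= M -> continuous h ->
  (forall x, h x != 0 -> - M <= x <= M) ->
  \int[mu]_x h x = oint 0 M h - oint 0 (- M) h.
Proof.
move=> M0 ch hM; have MM : - M <= M by lra.
exact: (RintegralT_antideriv MM ch hM (fun x => is_derive_oint x ch)).
Qed.

Lemma RintegralT_suppD h g c M : 0 <= M -> continuous h -> continuous g ->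
  (forall x, h x != 0 -> - M <= x <= M) -> (forall x, g x != 0 -> - M <= x <= M) ->
  \int[mu]_x (h x + c * g x) = \int[mu]_x h x + c * \int[mu]_x g x.
Proof.
move=> M0 ch cg hM gM; rewrite !(@RintegralT_oint _ M)//.
- by rewrite !ointD ?ointZ//; [ring|exact: continuous_pZ|exact: continuous_pZ].
- by apply: continuous_pD => //; exact: continuous_pZ.
- move=> x; have [->|/hM//] := eqVneq (h x) 0; rewrite add0r mulf_eq0 negb_or.
  by move=> /andP[_ /gM].
Qed.

Lemma supp_mull f g M : (forall x, g x != 0 -> - M <= x <= M) ->
  forall x, f x * g x != 0 -> - M <= x <= M.
Proof. by move=> gM x; rewrite mulf_eq0 negb_or => /andP[_ /gM]. Qed.

Lemma derive1_lin phi psi a : test_fun phi -> test_fun psi ->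
  derive1 (fun x => phi x + a * psi x) = (fun x => (derive1 phi) x + a * (derive1 psi) x).
Proof.
move=> tp tq; apply: is_derive_derive1E => x.
by apply: is_derive_pD; [exact: test_fun_derive|exact/is_derive_pZ/test_fun_derive].
Qed.

(** The distributional derivative of [F] as a functional. [is_primitive (dprim F) F] holds by
    conversion, so it supplies the witness wherever a distribution must be built from a
    primitive. *)
Definition dprim F : (R -> R) -> R := fun phi => - \int[mu]_x (F x * (derive1 phi) x).

Lemma dprim_linear F phi psi a : continuous F -> test_fun phi -> test_fun psi ->
  dprim F (fun x => phi x + a * psi x) = dprim F phi + a * dprim F psi.
Proof.
move=> cF tp tq; rewrite /dprim derive1_lin//.
have [M M0 [_ HM]] := test_fun_supp tp; have [N N0 [_ HN]] := test_fun_supp tq.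
rewrite (_ : (fun x => _) = fun x => F x * (derive1 phi) x + a * (F x * (derive1 psi) x)); last first.
  by apply/funext => x; ring.
rewrite (@RintegralT_suppD _ _ _ (M + N)); [by rewrite opprD mulrN|lra| | | |].
- exact/continuous_pM/test_fun_cont1.
- exact/continuous_pM/test_fun_cont1.
- by apply: supp_mull => x /HM; lra.
- by apply: supp_mull => x /HN; lra.
Qed.

Lemma dprimD F G phi : continuous F -> continuous G -> test_fun phi ->
  dprim (fun x => F x + G x) phi = dprim F phi + dprim G phi.
Proof.
move=> cF cG tp; rewrite /dprim; have [M M0 [_ HM]] := test_fun_supp tp.
rewrite (_ : (fun x => _) = fun x => F x * (derive1 phi) x + 1 * (G x * (derive1 phi) x)); last first.
  by apply/funext => x; ring.
rewrite (@RintegralT_suppD _ _ _ M)//; first by rewrite mul1r opprD.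
- exact/continuous_pM/test_fun_cont1.
- exact/continuous_pM/test_fun_cont1.
- exact: supp_mull.
- exact: supp_mull.
Qed.

Lemma dprimZ F c phi : continuous F -> test_fun phi ->
  dprim (fun x => c * F x) phi = c * dprim F phi.
Proof.
move=> cF tp; rewrite /dprim; have [M M0 [_ HM]] := test_fun_supp tp.
rewrite (_ : (fun x => _) = fun x => 0 * (derive1 phi) x + c * (F x * (derive1 phi) x)); last first.
  by apply/funext => x; ring.
rewrite (@RintegralT_suppD _ _ _ M)//.
- rewrite (_ : (fun x => 0 * _) = fun=> 0); last by apply/funext => x; rewrite mul0r.
  by rewrite Rintegral_cst ?mul0r; [ring|].
- by apply: continuous_pM; [move=> x; exact: cvg_cst|exact: test_fun_cont1].
- exact/continuous_pM/test_fun_cont1.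
- exact: supp_mull.
- exact: supp_mull.
Qed.

Lemma test_fun_bounded phi : test_fun phi ->
  has_ubound [set `|(derive1 phi) x| | x in [set: R]].
Proof.
move=> tp; have [M M0 [_ HM]] := test_fun_supp tp.
have [K K0 HK] : exists2 K, 0 <= K & forall x, `|(derive1 phi) x| <= K.
  have [||c _ Hc] := @EVT_max R (fun x => `|(derive1 phi) x|) (- M) M; first lra.
    apply: continuous_subspaceT => x; apply: continuous_comp; first exact: test_fun_cont1.
    exact: norm_continuous.
  exists `|(derive1 phi) c| => // x; have [->|x0] := eqVneq ((derive1 phi) x) 0; first by rewrite normr0.
  by apply: Hc; rewrite in_itv/=; exact: HM.
by exists K => _ [x _ <-].
Qed.

Lemma dprim_distr F : continuous F -> is_distr (dprim F).
Proof.
move=> cF; split; first by move=> *; exact: dprim_linear.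
move=> a b; have [ab|ba] := leP a b; last first.
  exists 0, 0%N => phi tp phiab.
  have phi0 : phi = fun=> 0.
    apply/funext => x; apply/eqP; apply: contraT => /phiab; lra.
  rewrite mul0r /dprim phi0 (is_derive_derive1E (is_derive_p1 (0 : R))).
  rewrite (_ : (fun x => _) = fun=> 0); last by apply/funext => x; rewrite mulr0.
  by rewrite Rintegral_cst// mul0r oppr0 normr0.
have [||c _ Hc] := @EVT_max R (fun x => `|F x|) a b; first lra.
  apply: continuous_subspaceT => x; apply: continuous_comp; first exact: cF.
  exact: norm_continuous.
(* The integral of [F phi'] over [[a, b]] is at most the maximum of [|F|] times the length times the
   supremum of [|phi'|]: a distribution of order at most one. *)
exists (`|F c| * (b - a)), 1%N => phi tp phiab.
have ub := test_fun_bounded tp.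
rewrite /dprim normrN big_ord_recl big_ord1.
pose S0 := sup [set `|phi x| | x in [set: R]].
pose S := sup [set `|derive1 phi x| | x in [set: R]].
rewrite -[X in _ <= _ * X]/(S0 + S).
(* Only the sign of [S0] matters, and it is right even for the default value 0 of [sup]; this spares
   a bound on [phi]. *)
have S00 : 0 <= S0.
  rewrite /S0; have [H|H] := pselect (has_ubound [set `|phi x| | x in [set: R]]).
    by rewrite (le_trans (normr_ge0 (phi 0)))//; apply: ub_le_sup => //; exists 0.
  by rewrite sup_out//; case.
have HS x : `|(derive1 phi) x| <= S by apply: ub_le_sup => //; exists x.
have S1 : 0 <= S by rewrite (le_trans _ (HS 0)).
have supp x : F x * (derive1 phi) x != 0 -> a <= x <= b.
  rewrite mulf_eq0 negb_or => /andP[_].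
  exact: (derive1_supp (fun y => test_fun_derive y tp) phiab).
have ch : continuous (fun x => F x * (derive1 phi) x) by exact/continuous_pM/test_fun_cont1.
rewrite (RintegralT_supp supp) -ointB_cont//.
rewrite (le_trans (@oint_le_weight _ _ (fun=> `|F c| * S) (fun x => (`|F c| * S) * x) _ _ ab ch _ _))//.
- move=> x; apply: (is_derive_eq (is_derive_pZ _ (is_derive_pX x))).
  by rewrite mulr1.
- by move=> x ax xb; rewrite normrM ler_pM// Hc// in_itv/= ax.
- have ab0 : 0 <= b - a by lra.
  by have := mulr_ge0 (mulr_ge0 (normr_ge0 (F c)) ab0) S00; lra.
Qed.

Lemma dprim_stieltjes w dw F phi : weight w dw -> continuous F -> test_fun phi ->
  dprim (stieltjes w dw F) phi = dprim F (fun x => w x * phi x).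
Proof.
move=> W cF tp; apply: (congr1 (fun z => - z)).
have cw := weight_cont W; have [wD cdw] := W; have cp := test_fun_cont tp.
have cp1 := test_fun_cont1 tp; have pD x := test_fun_derive x tp.
have [M M0 [HM HM1]] := test_fun_supp tp.
rewrite (is_derive_derive1E (fun x => is_derive_pM (wD x) (pD x))).
have cS := stieltjes_cont W cF.
pose h x := F x * dw x.
have ch : continuous h by exact: continuous_pM.
pose J x := oint 0 x h.
have JD x : is_derive x (1 : R) J (h x) by exact: is_derive_oint.
have c2 : continuous (fun x => F x * (dw x * phi x + w x * (derive1 phi) x)).
  by apply: continuous_pM => //; apply: continuous_pD; exact: continuous_pM.
have c1 : continuous (fun x => stieltjes w dw F x * (derive1 phi) x) by exact: continuous_pM.
have s1 : forall x, stieltjes w dw F x * (derive1 phi) x != 0 -> - M <= x <= M.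
  exact: supp_mull.
have s2 : forall x, F x * (dw x * phi x + w x * (derive1 phi) x) != 0 -> - M <= x <= M.
  apply: supp_mull => x; have [p0|/HM//] := eqVneq (phi x) 0.
  by rewrite p0 mulr0 add0r mulf_eq0 negb_or => /andP[_ /HM1].
pose P2 x := oint 0 x (fun x => F x * (dw x * phi x + w x * (derive1 phi) x)).
(* The two integrands differ by the derivative of [J phi], and [J phi] vanishes at both ends. *)
have D1 x : is_derive x (1 : R) (fun x => P2 x - J x * phi x) (stieltjes w dw F x * (derive1 phi) x).
  apply: (is_derive_eq (is_derive_pB (is_derive_oint x c2) (is_derive_pM (JD x) (pD x)))).
  by rewrite /stieltjes -/(J x) /h; ring.
have phiM x : M < x -> phi x = 0.
  by move=> Mx; apply/eqP; apply: contraT => /HM; lra.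
have phiNM x : x < - M -> phi x = 0.
  by move=> Mx; apply/eqP; apply: contraT => /HM; lra.
(* The support may reach [M] itself, so [phi] is evaluated one unit further out, where it is visibly
   0. *)
have MM : - (M + 1) <= M + 1 by lra.
have wide f : (forall x, f x != 0 -> - M <= x <= M) ->
    forall x, f x != 0 -> - (M + 1) <= x <= M + 1 by move=> fM x /fM; lra.
rewrite (RintegralT_antideriv MM c1 (wide _ s1) D1).
rewrite (RintegralT_antideriv MM c2 (wide _ s2) (fun x => is_derive_oint x c2)).
rewrite -/(P2 (M + 1)) -/(P2 (- (M + 1))).
by rewrite phiM ?(phiNM (- (M + 1))) ?mulr0 ?subr0//; lra.
Qed.

End TestFunctions.

(** * Uniqueness of primitives *)

Section Mollifiers.
Variable R : realType.
Local Notation mu := (@lebesgue_measure R).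
Implicit Types (f g h P Q F G H w dw phi psi : R -> R) (a b c d e x y K M : R) (n k : nat).

(** The classical smooth function [exp (- 1 / x)], with the factor [x^(-k)] added so that the family
    is closed under differentiation up to linear combinations. *)
Definition flat k x := if 0 < x then x^-1 ^+ k * expR (- x^-1) else 0.

(** With [t = 1 / x], the inequality [exp t >= t^(k+1) / (k+1)!] gives
    [t^k exp (- t) <= (k+1)! / t]. A linear bound suffices for continuity at 0. *)
Lemma flat_bound k x : `|flat k x| <= k.+1`!%:R * `|x|.
Proof.
rewrite /flat; case: ifPn => [x0|_]; last by rewrite normr0 mulr_ge0.
have t0 : 0 < x^-1 by rewrite invr_gt0.
rewrite ger0_norm; last by rewrite mulr_ge0 ?exprn_ge0 ?ltW ?expR_gt0.
rewrite (gtr0_norm x0) expRN ler_pdivrMr ?expR_gt0//.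
have := expR_ge1Dxn k (ltW t0); set E := expR _ => HE.
have f0 : 0 < (k.+1`!%:R : R) by rewrite ltr0n fact_gt0.
have : x^-1 ^+ k.+1 / k.+1`!%:R <= E by lra.
rewrite ler_pdivrMr// exprS => A.
have -> : x^-1 ^+ k = x * (x^-1 * x^-1 ^+ k) by rewrite mulVKf ?gt_eqF.
rewrite (_ : _ * x * E = x * (E * k.+1`!%:R)); last by ring.
by rewrite ler_pM2l.
Qed.

Lemma is_derive_pXn k x : is_derive x (1 : R) (fun y => y ^+ k) (k%:R * x ^+ k.-1).
Proof.
elim: k => [|k IH].
  by under [X in is_derive _ _ X]funext => y do rewrite expr0; rewrite mul0r; exact: is_derive_p1.
under [X in is_derive _ _ X]funext => y do rewrite exprS.
apply: (is_derive_eq (is_derive_pM (is_derive_pX x) IH)).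
case: k {IH} => [|k]; first by rewrite expr0; ring.
by rewrite /= exprS -[k.+2%:R]natr1; ring.
Qed.

Lemma is_derive_flat k x : is_derive x 1 (flat k) (- k%:R * flat k.+1 x + flat k.+2 x).
Proof.
have [x0|x0|->] := ltgtP x 0.
- apply: (@near_eq_is_derive _ _ _ (fun=> 0)).
    near=> y; rewrite /flat ifF//; apply/negbTE; rewrite -leNgt ltW//.
    by near: y; exact: lt_nbhsl.
  apply: (is_derive_eq (is_derive_p1 (0 : R) x)).
  by rewrite /flat ltNge ltW//= mulr0 addr0.
- pose g y : R := y^-1 ^+ k * expR (- y^-1).
  apply: (@near_eq_is_derive _ _ _ g).
    by near=> y; rewrite /flat ifT//; near: y; exact: lt_nbhsr.
  have xn0 : x != 0 by rewrite gt_eqF.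
  have V : is_derive x 1 (fun y : R => y^-1) (- x^-1 ^+ 2).
    apply: (is_derive_eq (@is_deriveV R id x 1 1 xn0 (is_derive_id _ _))).
    by rewrite /GRing.scale/= mulr1 exprVn.
  have X := is_derive_pXn k x^-1.
  apply: (is_derive_eq (is_derive_pM (is_derive_pcomp X V) (is_derive_pexp (is_derive_pN V)))).
  rewrite /flat x0; case: k {X g} => [|k]; first by rewrite /= !exprS expr0; ring.
  by rewrite /= !exprS; ring.
(* At 0 the slope function of [flat k] is [flat k.+1], because [flat k z = z * flat k.+1 z]; its
   continuity at 0 comes from the linear bound. *)
- apply/is_derive1_caratheodory; exists (flat k.+1); split.
  + move=> z; rewrite /flat ltxx !subr0; case: ifPn => [z0|_]; last by rewrite mul0r.
    by rewrite exprS; field; rewrite gt_eqF.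
  + apply/cvgrPdist_le => e e0; apply/nbhs_ballP.
    have f0 : 0 < (k.+2`!%:R : R) by rewrite ltr0n fact_gt0.
    exists (e / k.+2`!%:R) => /=; first by rewrite divr_gt0.
    move=> y; rewrite /ball/= sub0r normrN => ye.
    rewrite {1}/flat ltxx sub0r normrN (le_trans (flat_bound _ _))//.
    by rewrite mulrC -ler_pdivlMr// ltW.
  + by rewrite /flat ltxx mulr0 addr0.
Unshelve. all: by end_near. Qed.

Lemma diffn_flat n k : diffn n (flat k).
Proof.
elim: n k => [//|n IH] k; apply: (diffn_step (is_derive_flat k)).
by apply: diffnD => //; apply: diffnM => //; exact: diffn_cst.
Qed.

(** A bump supported in [[- e, e]], left unnormalised since only the positivity of its mass is used.
    The coefficients [1] and [-1] match the shape of [diffn_affine]. *)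
Definition mollifier e x := flat 0 (1 * x + e) * flat 0 (-1 * x + e).

Lemma diffn_mollifier n e : diffn n (mollifier e).
Proof. by apply: diffnM; apply: diffn_affine; exact: diffn_flat. Qed.

Lemma mollifier_ge0 e x : 0 <= mollifier e x.
Proof.
by rewrite /mollifier /flat; apply: mulr_ge0; case: ifP => // _;
  rewrite expr0 mul1r expR_ge0.
Qed.

Lemma mollifier_gt0 e x : - e < x -> x < e -> 0 < mollifier e x.
Proof.
move=> ex xe; rewrite /mollifier /flat !ifT; [|lra|lra].
by rewrite !expr0 !mul1r mulr_gt0// expR_gt0.
Qed.

Lemma mollifier_supp e x : mollifier e x != 0 -> - e <= x <= e.
Proof.
rewrite /mollifier /flat; case: ifPn => [h1|_]; last by rewrite mul0r eqxx.
case: ifPn => [h2 _|_]; last by rewrite mulr0 eqxx.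
by apply/andP; split; lra.
Qed.

Lemma is_derive_const P h a b : (forall x, is_derive x 1 P (h x)) -> a <= b ->
  (forall x, a <= x -> x <= b -> h x = 0) -> P a = P b.
Proof.
move=> PD ab h0; apply/eqP; rewrite eq_le; apply/andP; split.
  by apply: (is_derive_le PD) => // x ax xb; rewrite h0.
rewrite -lerN2; apply: (is_derive_le (fun x => is_derive_pN (PD x)) ab).
by move=> x ax xb; rewrite h0// oppr0.
Qed.

(* du Bois-Reymond: tested against the derivative of the difference of two translated
   primitives of a mollifier, [F] has equal local averages at any two points. *)
Lemma primitive_constant F : continuous F ->
  (forall phi, test_fun phi -> \int[mu]_x (F x * (derive1 phi) x) = 0) ->
  forall p q, F p = F q.
Proof.
move=> cF H0; suff A p q : ~ F p < F q.
  by move=> p q; case: (ltgtP (F p) (F q)) => // /A.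
(* The gap is [2 c]; a tolerance of [c / 2] around each of [p] and [q] leaves
   [F (t + q) - F (t + p) >= c] for [|t| <= e]. *)
move=> Fpq; set c := (F q - F p) / 2; have c0 : 0 < c by rewrite /c; lra.
have c20 : 0 < c / 2 by lra.
have /continuous_epsP cF' := cF.
have [d1 d10 H1] := cF' p _ c20; have [d2 d20 H2] := cF' q _ c20.
pose e := Num.min d1 d2 / 2.
have m0 : 0 < Num.min d1 d2 by rewrite lt_min d10.
have e0 : 0 < e by rewrite /e; lra.
have ed1 : e < d1 by have : Num.min d1 d2 <= d1 by [rewrite ge_min lexx]; rewrite /e; lra.
have ed2 : e < d2 by have : Num.min d1 d2 <= d2 by [rewrite ge_min lexx orbT]; rewrite /e; lra.
set rho := mollifier e.
have rD n : diffn n rho by exact: diffn_mollifier.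
have cr : continuous rho.
  by have [D _] := rD 1%N; apply: is_derive_continuous => x; exact: is_derive_derive1.
pose S x := oint 0 x rho.
have SD x : is_derive x (1 : R) S (rho x) by exact: is_derive_oint.
have rho0 x : ~~ (- e <= x <= e) -> rho x = 0.
  by move=> xe; apply/eqP; apply: contraNT xe; exact: mollifier_supp.
have shiftD P h a x : (forall x, is_derive x (1 : R) P (h x)) ->
    is_derive x (1 : R) (fun x => P (x - a)) (h (x - a)).
  move=> PD; apply: (is_derive_eq (@is_derive_pcomp _ P (fun x => x - a) x _ _ (PD (x - a))
    (is_derive_pB (is_derive_pX x) (is_derive_p1 a x)))).
  by rewrite subr0 mul1r.
pose chi x := S (x - p) - S (x - q).
have chiD x : is_derive x (1 : R) chi (rho (x - p) - rho (x - q)).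
  exact: is_derive_pB (shiftD _ _ p x SD) (shiftD _ _ q x SD).
(* Both translated bumps lie in [[- M, M]]. The extra 1 puts [M - p] and [M - q] strictly beyond
   [e], where [S], [P1] and [P2] are constant; there the two copies of [S] in [chi] cancel. *)
pose M := `|p| + `|q| + e + 1.
have bp : - `|p| <= p <= `|p| by rewrite -ler_norml.
have bq : - `|q| <= q <= `|q| by rewrite -ler_norml.
have M0 : 0 <= M by rewrite /M; lra.
have right P h x y : (forall x, is_derive x (1 : R) P (h x * rho x)) -> e < x -> e < y -> P x = P y.
  move=> PD; wlog xy : x y / x <= y.
    by move=> W ex ey; case: (leP x y) => [/W|/ltW/W H]; [exact|rewrite H].
  move=> ex ey; apply: (is_derive_const PD) => // z xz _.
  by rewrite rho0 ?mulr0//; apply/negP; lra.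
have left P h x y : (forall x, is_derive x (1 : R) P (h x * rho x)) -> x < - e -> y < - e -> P x = P y.
  move=> PD; wlog xy : x y / x <= y.
    by move=> W ex ey; case: (leP x y) => [/W|/ltW/W H]; [exact|rewrite H].
  move=> ex ey; apply: (is_derive_const PD) => // z _ zy.
  by rewrite rho0 ?mulr0//; apply/negP; lra.
have SD' x : is_derive x (1 : R) S (1 * rho x) by rewrite mul1r.
have tchi : test_fun chi.
  apply/test_funP; split.
    case=> [//|n]; apply: (diffn_step chiD); apply: diffnD.
      have := diffn_affine 1 (- p) (rD n).
      by under [X in diffn _ X -> _]funext => x do rewrite mul1r.
    have := diffnM (diffn_cst n (-1)) (diffn_affine 1 (- q) (rD n)).
    by under [X in diffn _ X -> _]funext => x do rewrite mul1r mulN1r.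
  exists M => // x; apply: contraNT => xM; rewrite /chi subr_eq0; apply/eqP.
  have [x0|x0] := leP 0 x.
    by apply: (right _ _ _ _ SD'); move: xM; rewrite /M negb_and -!ltNge; lra.
  by apply: (left _ _ _ _ SD'); move: xM; rewrite /M negb_and -!ltNge; lra.
(* The averages of [F] around [p] and [q] are recentred at 0 so that both carry the same bump and
   can be compared pointwise. *)
pose P1 x := oint 0 x (fun t => F (t + p) * rho t).
pose P2 x := oint 0 x (fun t => F (t + q) * rho t).
have cs a : continuous (fun t => F (t + a) * rho t).
  apply: continuous_pM => //; apply: continuous_pcomp => // x.
  by apply: cvgD; [exact: cvg_id|exact: cvg_cst].
have P1D x : is_derive x (1 : R) P1 (F (x + p) * rho x) by exact: (is_derive_oint x (cs p)).
have P2D x : is_derive x (1 : R) P2 (F (x + q) * rho x) by exact: (is_derive_oint x (cs q)).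
have PD x : is_derive x (1 : R) (fun x => P1 (x - p) - P2 (x - q)) (F x * (derive1 chi) x).
  apply: (is_derive_eq (is_derive_pB (shiftD _ _ p x P1D) (shiftD _ _ q x P2D))).
  by rewrite (is_derive_derive1E chiD) !subrK; ring.
have := H0 chi tchi.
have MM : - M <= M by lra.
have chis x : F x * (derive1 chi) x != 0 -> - M <= x <= M.
  rewrite mulf_eq0 negb_or (is_derive_derive1E chiD) => /andP[_]; apply: contraNT.
  rewrite /M negb_and -!ltNge => xM.
  by rewrite !rho0 ?subrr//; apply/negP; lra.
rewrite (RintegralT_antideriv MM (continuous_pM cF (test_fun_cont1 tchi)) chis PD).
rewrite (right P1 (fun x => F (x + p)) (M - p) (e + 1))//; [|rewrite /M; lra|lra].
rewrite (right P2 (fun x => F (x + q)) (M - q) (e + 1))//; [|rewrite /M; lra|lra].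
rewrite (left P1 (fun x => F (x + p)) (- M - p) (- (e + 1)))//; [|rewrite /M; lra|lra].
rewrite (left P2 (fun x => F (x + q)) (- M - q) (- (e + 1)))//; [|rewrite /M; lra|lra].
move=> E.
have e1 : - (e + 1) <= e + 1 by lra.
(* The expression [c S - (P2 - P1)] is nonincreasing. The increments of [P1] and [P2] agree by [E],
   so [c] times the mass of the bump would be at most 0. *)
have L : c * S (- (e + 1)) - (P2 (- (e + 1)) - P1 (- (e + 1))) >=
         c * S (e + 1) - (P2 (e + 1) - P1 (e + 1)).
  have LD x := is_derive_pB (is_derive_pZ c (SD x)) (is_derive_pB (P2D x) (P1D x)).
  rewrite -lerN2; apply: (is_derive_le (fun x => is_derive_pN (LD x)) e1).
  move=> x _ _; rewrite -mulrBl -mulrBl oppr_ge0.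
  have [xe|xe] := boolP (- e <= x <= e); last by rewrite rho0// mulr0.
  rewrite mulr_le0_ge0 ?mollifier_ge0//.
  have xe' : `|x| <= e by rewrite ler_norml.
  have := H1 (x + p); have := H2 (x + q).
  rewrite !(addrC x) !opprD !addrA !subrr !sub0r !normrN => /(_ ltac:(lra)) + /(_ ltac:(lra)).
  by rewrite !ler_norml /c; lra.
(* The mass is positive because the mean value point lies in the open interval, where the bump is
   positive. *)
have [z] : exists2 z, z \in `]- e, e[ & S e - S (- e) = rho z * (e - - e).
  have ee : - e < e by lra.
  apply: (MVT ee (fun x _ => SD x)).
  exact/continuous_subspaceT/(is_derive_continuous SD).
rewrite in_itv/= => /andP[ez ze] Se.
have Sp : 0 < S e - S (- e) by rewrite Se mulr_gt0 ?mollifier_gt0//; lra.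
have S1 : S e <= S (e + 1).
  by apply: (is_derive_le SD) => [|x _ _]; [lra|exact: mollifier_ge0].
have S2 : S (- (e + 1)) <= S (- e).
  by apply: (is_derive_le SD) => [|x _ _]; [lra|exact: mollifier_ge0].
have : 0 < c * (S (e + 1) - S (- (e + 1))) by rewrite mulr_gt0//; lra.
lra.
Qed.

End Mollifiers.

(** * The Banach spaces and their inclusions *)

Section Spaces.
Variable R : realType.
Local Notation mu := (@lebesgue_measure R).
Implicit Types (f g h P Q F G H w dw phi psi : R -> R) (a b c d e x y K M tau r s : R) (n : nat).
Implicit Types (T U : (R -> R) -> R).

Lemma stieltjes_lin w dw F G a : weight w dw -> continuous F -> continuous G ->
  stieltjes w dw (fun x => F x + a * G x) =
  fun x => stieltjes w dw F x + a * stieltjes w dw G x.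
Proof.
move=> W cF cG; apply/funext => x; have cG' := continuous_pZ (c := a) cG.
by rewrite (stieltjesD _ W cF cG') stieltjesZ.
Qed.

Lemma gstieltjes_lin c F G a : continuous F -> continuous G ->
  gstieltjes c (fun x => F x + a * G x) =
  fun x => gstieltjes c F x + a * gstieltjes c G x.
Proof. exact/stieltjes_lin/gauss_weight. Qed.

Lemma gstieltjes_zero c : gstieltjes c (fun=> 0) = fun=> 0.
Proof. by apply/funext => x; rewrite /gstieltjes (stieltjes_cst _ _ (gauss_weight c)) mul0r. Qed.

Lemma gstieltjesZ c F a : continuous F ->
  gstieltjes c (fun x => a * F x) = fun x => a * gstieltjes c F x.
Proof. by move=> cF; apply/funext => x; exact/stieltjesZ/cF/gauss_weight. Qed.

Lemma gstieltjesD c F G : continuous F -> continuous G ->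
  gstieltjes c (fun x => F x + G x) = fun x => gstieltjes c F x + gstieltjes c G x.
Proof. by move=> cF cG; apply/funext => x; exact/stieltjesD/cG/cF/gauss_weight. Qed.

Lemma dprim_gstieltjes c F phi : continuous F -> test_fun phi ->
  dprim (gstieltjes c F) phi = dprim F (fun x => gauss c x * phi x).
Proof. exact/dprim_stieltjes/gauss_weight. Qed.

Lemma gstieltjes_const c F x y : continuous F -> x <= y ->
  (forall t, x <= t -> t <= y -> F t = F x) -> gstieltjes c F y = gstieltjes c F x.
Proof. exact/stieltjes_const/gauss_weight. Qed.

Lemma gstieltjes_antideriv c H h P x y : continuous h ->
  (forall x, is_derive x (1 : R) H (h x)) ->
  (forall x, is_derive x (1 : R) P (h x * gauss c x)) ->
  gstieltjes c H y - gstieltjes c H x = P y - P x.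
Proof. exact/stieltjes_antideriv/gauss_weight. Qed.

(* Keeps failing conversions between primitives with different weights from
   unfolding down to the integral. *)
Local Opaque gstieltjes normB.

Lemma dprim_lin F G a phi : continuous F -> continuous G -> test_fun phi ->
  dprim (fun x => F x + a * G x) phi = dprim F phi + a * dprim G phi.
Proof.
move=> cF cG tp; have cG' := continuous_pZ (c := a) cG.
by rewrite (dprimD cF cG' tp) (dprimZ _ cG tp).
Qed.

Lemma dprim_cst c phi : test_fun phi -> dprim (fun=> c) phi = 0.
Proof.
move=> tp; have [M M0 [HM HM1]] := test_fun_supp tp.
have MM : - (M + 1) <= M + 1 by lra.
have cc : continuous (fun x => c * derive1 phi x) by exact/continuous_pZ/test_fun_cont1.
have s x : c * derive1 phi x != 0 -> - (M + 1) <= x <= M + 1.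
  by rewrite mulf_eq0 negb_or => /andP[_ /HM1]; lra.
rewrite /dprim (RintegralT_antideriv MM cc s (fun x => is_derive_pZ c (test_fun_derive x tp))).
have p0 x : ~~ (- M <= x <= M) -> phi x = 0.
  by move=> xM; apply/eqP; apply: contraNT xM; exact: HM.
by rewrite !p0 ?mulr0 ?subrr ?oppr0//; apply/negP; lra.
Qed.

Lemma is_primitive_unique T F G : continuous F -> continuous G ->
  is_primitive T F -> is_primitive T G -> forall x y, F x - F y = G x - G y.
Proof.
move=> cF cG TF TG.
have cFG : continuous (fun x => F x + -1 * G x).
  by apply: continuous_pD => //; exact: continuous_pZ.
suff H x y : F x + -1 * G x = F y + -1 * G y by move=> x y; have := H x y; lra.
apply: (primitive_constant cFG) => phi tp.
have := dprim_lin (-1) cF cG tp; rewrite -[dprim F phi](TF _ tp) -[dprim G phi](TG _ tp).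
by rewrite /dprim mulN1r subrr => /eqP; rewrite oppr_eq0 => /eqP.
Qed.

Lemma is_primitive_lin T U F G a : continuous F -> continuous G ->
  is_primitive T F -> is_primitive U G ->
  is_primitive (distr_add T (distr_scale a U)) (fun x => F x + a * G x).
Proof.
move=> cF cG TF UG phi tp; rewrite /distr_add /distr_scale (TF _ tp) (UG _ tp).
exact/esym/dprim_lin.
Qed.

Lemma is_primitive_shift T G c : continuous G -> is_primitive T G ->
  is_primitive T (fun x => G x - c).
Proof.
move=> cG TG phi tp; rewrite (TG _ tp) -/(dprim G phi) -/(dprim (fun x => G x - c) phi).
have c1 : continuous (fun _ : R => 1 : R) by move=> x; exact: cvg_cst.
have -> : (fun x => G x - c) = (fun x => G x + (- c) * 1).
  by apply/funext => x; rewrite mulr1.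
by rewrite dprim_lin// dprim_cst// mulr0 addr0.
Qed.

Lemma is_distr_primitive T F : continuous F -> is_primitive T F -> is_distr T.
Proof.
move=> cF TF; have [D1 D2] := dprim_distr cF; split.
  move=> a phi psi tp tq; rewrite (TF _ tp) (TF _ tq) (TF _ _); first exact: D1.
  apply: test_funD => //; apply: test_funM => // n; exact: diffn_cst.
move=> a b; have [C [N H]] := D2 a b; exists C, N => phi tp pab.
by rewrite (TF _ tp); exact: H.
Qed.

Lemma is_primitive_gauss T F c : continuous F -> is_primitive T F ->
  is_primitive (distr_mulw T (gauss c)) (gstieltjes c F).
Proof.
move=> cF TF phi tp; rewrite /distr_mulw (TF _ (test_fun_gauss c tp)).
exact/esym/dprim_gstieltjes.
Qed.

Lemma is_primitive_gaussK T c F : continuous F ->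
  is_primitive (distr_mulw T (gauss c)) F -> is_primitive T (gstieltjes (- c) F).
Proof.
move=> cF TF phi tp; have := is_primitive_gauss (- c) cF TF tp.
rewrite /distr_mulw => <-; congr T; apply/funext => x.
by rewrite mulrA gaussD addrN /gauss mul0r expR0 mul1r.
Qed.

(** * Normalised primitives and the norms of distributions *)

Lemma BcP G : Bc G <-> has_limits G /\ G x @[x --> -oo] --> 0.
Proof.
split=> [[cG [G1 G2]]|[[cG /osc_vanishesP[G1 _]] G2]]; last by [].
split=> //; split=> //; apply/osc_vanishesP; split=> //.
by apply/cvg_ex; exists 0.
Qed.

Lemma has_limits_Bc G : has_limits G ->
  Bc (fun x => G x - lim (G y @[y --> -oo])).
Proof.
move=> lG; apply/BcP; split; first exact: (has_limitsB lG (has_limits_cst _)).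
have /osc_vanishesP[_ G2] := lG.2.
rewrite -(subrr (lim (G y @[y --> -oo]))).
by apply: cvgB => //; exact: cvg_cst.
Qed.

Lemma normB_shift G c : normB (fun x => G x - c) = normB G.
Proof. by apply: normB_eq => x y; ring. Qed.

(** The set under the supremum is a singleton: primitives differ by constants, which [normB]
    ignores. Hence any primitive with limits computes the norm, not only the one vanishing at minus
    infinity. *)
Lemma anormE T G : has_limits G -> is_primitive T G -> anorm T = normB G.
Proof.
move=> lG TG; rewrite /anorm.
rewrite (_ : [set _ | _ in _] = [set normB G]) ?sup1//; apply/seteqP; split.
  move=> _ [H [/BcP[lH _] TH] <-] /=; apply: normB_eq.
  exact: (is_primitive_unique lH.1 lG.1 TH TG).
move=> _ ->; exists (fun x => G x - lim (G y @[y --> -oo])); last exact: normB_shift.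
split; first exact: has_limits_Bc.
exact: is_primitive_shift lG.1 TG.
Qed.

Lemma AcP T : Ac T <-> exists2 G, has_limits G & is_primitive T G.
Proof.
split=> [[_ [G [/BcP[lG _] TG]]]|[G lG TG]]; first by exists G.
split; first exact: (is_distr_primitive lG.1 TG).
exists (fun x => G x - lim (G y @[y --> -oo])); split; first exact: has_limits_Bc.
exact: is_primitive_shift lG.1 TG.
Qed.

Definition rate tau : R := (4 * tau)^-1.

Lemma rate_gt0 tau : 0 < tau -> 0 < rate tau.
Proof. by move=> t0; rewrite /rate invr_gt0 mulr_gt0. Qed.

Lemma rate_lt r s : 0 < r -> r < s -> rate s < rate r.
Proof. by move=> r0 rs; rewrite /rate ltf_pV2 ?posrE; lra. Qed.

(** [Bctau] described by the exponent [c = rate tau]. A free real [c] also admits [c = 0], which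
    describes the primitives of [Ac] anchored at 0, so the inclusion in (e) is a case of
    monotonicity in [c]. *)
Definition wprim c F := [/\ continuous F, F 0 = 0 & has_limits (gstieltjes (- c) F)].

(** Evaluating the Volterra equation at 0 forces [F 0 = 0]. Conversely [G] is the transform of [F],
    shifted to vanish at minus infinity. *)
Lemma BctauP tau F : 0 < tau -> Bctau tau F <-> wprim (rate tau) F.
Proof.
move=> t0; split=> [[G [/BcP[lG _] [cF V]]]|[cF F0 lF]].
  rewrite /volterra voltE// -/(rate tau) in V; split=> //.
    by have := V 0; rewrite subrr gstieltjes_at0.
  rewrite (_ : gstieltjes _ _ = fun x => G x - G 0); last first.
    by apply/funext => x; rewrite V.
  exact: (has_limitsB lG (has_limits_cst _)).
exists (fun x => gstieltjes (- rate tau) F x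
   - lim (gstieltjes (- rate tau) F y @[y --> -oo])).
split; first exact: has_limits_Bc.
by split=> // x; rewrite voltE// -/(rate tau) gstieltjes_at0 F0; ring.
Qed.

Lemma normBtauE tau F : 0 < tau -> continuous F ->
  normBtau tau F = normB (gstieltjes (- rate tau) F).
Proof. by move=> t0 cF; rewrite /normBtau voltE. Qed.

Lemma wprim_unique c T F G : wprim c F -> wprim c G ->
  is_primitive T F -> is_primitive T G -> F = G.
Proof.
move=> [cF F0 _] [cG G0 _] TF TG; apply/funext => x.
by have := is_primitive_unique cF cG TF TG x 0; rewrite F0 G0 !subr0.
Qed.

Lemma tnormE tau T F : 0 < tau -> wprim (rate tau) F -> is_primitive T F ->
  tnorm tau T = normB (gstieltjes (- rate tau) F).
Proof.
move=> t0 wF TF; rewrite /tnorm.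
rewrite (_ : [set _ | _ in _] = [set normB (gstieltjes (- rate tau) F)]) ?sup1//.
apply/seteqP; split.
  move=> _ [H [/(BctauP _ t0) wH TH] <-] /=.
  by rewrite (wprim_unique wH wF TH TF) normBtauE//; case: wF.
move=> _ ->; exists F; first by split=> //; apply/BctauP.
by rewrite normBtauE//; case: wF.
Qed.

Lemma ActauP tau T : 0 < tau -> Actau tau T <-> exists2 F, wprim (rate tau) F & is_primitive T F.
Proof.
move=> t0; split=> [[_ [F [/(BctauP _ t0) wF TF]]]|[F wF TF]]; first by exists F.
split; first by apply: (is_distr_primitive _ TF); case: wF.
by exists F; split=> //; apply/BctauP.
Qed.

Lemma wprim_lin c F G a : wprim c F -> wprim c G -> wprim c (fun x => F x + a * G x).
Proof.
move=> [cF F0 lF] [cG G0 lG]; split.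
- by apply: continuous_pD => //; exact: continuous_pZ.
- by rewrite F0 G0 mulr0 addr0.
- by rewrite gstieltjes_lin//; apply: has_limitsD => //; exact: has_limitsZ.
Qed.

Lemma wprim0 c : wprim c (fun=> 0).
Proof.
split=> //; first by move=> x; exact: cvg_cst.
by rewrite gstieltjes_zero; exact: has_limits_cst.
Qed.

Lemma wprimZ c F a : wprim c F -> wprim c (fun x => a * F x).
Proof.
move=> /(@wprim_lin c _ _ a (wprim0 c)).
by under [X in wprim _ X -> _]funext => x do rewrite add0r.
Qed.

Lemma wprimD c F G : wprim c F -> wprim c G -> wprim c (fun x => F x + G x).
Proof.
move=> wF /(wprim_lin 1 wF).
by under [X in wprim _ X -> _]funext => x do rewrite mul1r.
Qed.

Lemma wprim_gstieltjes c G : has_limits G -> G 0 = 0 -> wprim c (gstieltjes c G).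
Proof.
move=> lG G0; split; first exact/gstieltjes_cont/lG.1.
  by rewrite gstieltjes_at0.
by rewrite gstieltjesK//; exact: lG.1.
Qed.

Lemma wprim_norm_eq0 c F : wprim c F -> normB (gstieltjes (- c) F) = 0 -> F = fun=> 0.
Proof.
move=> [cF F0 lF] N0; rewrite -[F](gstieltjesNK c cF) -(gstieltjes_zero c).
congr gstieltjes; apply/funext => x.
by rewrite (normB_eq0 lF N0 x 0) gstieltjes_at0.
Qed.

Lemma wprim_complete c (u : nat -> R -> R) : (forall n, wprim c (u n)) ->
  (forall e, 0 < e -> exists N, forall m n, (N <= m)%N -> (N <= n)%N ->
     normB (gstieltjes (- c) (fun x => u m x + -1 * u n x)) < e) ->
  exists2 F, wprim c F & forall e, 0 < e -> exists N, forall n, (N <= n)%N ->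
    normB (gstieltjes (- c) (fun x => u n x + -1 * F x)) < e.
Proof.
move=> wu uC; have cu n : continuous (u n) by case: (wu n).
have [|n||G [lG G0] HG] := @has_limits_complete R (fun n => gstieltjes (- c) (u n)).
- by move=> n; case: (wu n).
- by rewrite gstieltjes_at0; case: (wu n).
- move=> e /uC[N HN]; exists N => m n Nm Nn; rewrite (le_lt_trans _ (HN m n Nm Nn))//.
  by rewrite gstieltjes_lin// le_eqVlt; apply/orP; left; apply/eqP; apply: normB_eq => x y; ring.
exists (gstieltjes c G); first exact: wprim_gstieltjes.
move=> e /HG[N HN]; exists N => n Nn; rewrite (le_lt_trans _ (HN n Nn))//.
rewrite gstieltjes_lin// ?gstieltjesK//; [|exact: lG.1|exact/gstieltjes_cont/lG.1].
by rewrite le_eqVlt; apply/orP; left; apply/eqP; apply: normB_eq => x y; ring.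
Qed.

(** * Completeness and the isometries *)

Lemma Bctau_banach tau : 0 < tau ->
  banach_space (@eq (R -> R)) (fun _ => 0) (@fadd R) (@fscale R) (Bctau tau) (normBtau tau).
Proof.
move=> t0; rewrite /banach_space.
have B F : Bctau tau F <-> wprim (rate tau) F by exact: BctauP.
have cB F : Bctau tau F -> continuous F by move/B; case.
have lB F : Bctau tau F -> has_limits (gstieltjes (- rate tau) F) by move/B; case.
have N F : Bctau tau F -> normBtau tau F = normB (gstieltjes (- rate tau) F).
  by move=> /cB; exact: normBtauE.
have SD F G : Bctau tau F -> Bctau tau G -> Bctau tau (fadd F G).
  by move=> /B wF /B wG; apply/B; exact: wprimD.
have SZ a F : Bctau tau F -> Bctau tau (fscale a F).
  by move=> /B wF; apply/B; exact: wprimZ.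
have S0 : Bctau tau (fun=> 0) by apply/B; exact: wprim0.
do 3 (split=> //); split; [|split; [|split]].
- move=> F SF; rewrite N//; split; first exact/normB_ge0/lB.
  split=> [|->]; first by apply: wprim_norm_eq0; apply/B.
  rewrite gstieltjes_zero; apply/eqP; rewrite eq_le normB_ge0 ?andbT; last exact: has_limits_cst.
  by apply: normB_le => x y _; rewrite subrr normr0.
- move=> a F SF; rewrite !N//; last exact: SZ.
  by rewrite [gstieltjes _ (fscale a F)]gstieltjesZ ?normBZ//; [exact: lB|exact: cB].
- move=> F G SF SG; rewrite !N//; last exact: SD.
  by rewrite [gstieltjes _ (fadd F G)]gstieltjesD ?normBD//;
    [exact: lB|exact: lB|exact: cB|exact: cB].
- move=> u Su uC; have [|e e0|F wF HF] := @wprim_complete (rate tau) u.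
  + by move=> n; apply/B.
  + have [M HM] := uC e e0; exists M => m n Mm Mn.
    by have := HM m n Mm Mn; rewrite N//; apply: SD => //; exact: SZ.
  have SF : Bctau tau F by apply/B.
  exists F; split=> // e /HF[M HM]; exists M => n Mn.
  by rewrite N; [exact: HM|apply: SD => //; exact: SZ].
Qed.

Lemma Bctau_isometry tau : 0 < tau ->
  isometrically_isomorphic
      (@eq (R -> R)) (@fadd R) (@fscale R) (Bctau tau) (normBtau tau)
      (@eq (R -> R)) (@fadd R) (@fscale R) (@Bc R) (@normB R).
Proof.
move=> t0; rewrite /isometrically_isomorphic.
have B F : Bctau tau F <-> wprim (rate tau) F by exact: BctauP.
pose S F := gstieltjes (- rate tau) F; pose l F := lim (S F y @[y --> -oo]).
have lS F : Bctau tau F -> has_limits (S F) by move/B; case.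
have cB F : Bctau tau F -> continuous F by move/B; case.
have cvgS F : Bctau tau F -> S F y @[y --> -oo] --> l F.
  by move=> /lS[_ /osc_vanishesP[_ ?]].
(* [S F] is [G - G 0]; subtracting its limit moves the normalisation from 0 to minus infinity and
   recovers the [G] of the Volterra equation. *)
exists (fun F x => S F x - l F); split; [|split; [|split; [|split; [|split; [|split]]]]].
- by move=> F /lS; exact: has_limits_Bc.
- by move=> F F' _ ->.
- move=> F G SF SG; have SE : S (fadd F G) = fun x => S F x + S G x.
    by apply: gstieltjesD; exact: cB.
  have -> : l (fadd F G) = l F + l G.
    by rewrite /l SE; apply/cvg_lim => //; apply: cvgD; exact: cvgS.
  by apply/funext => x; rewrite SE /fadd; ring.
- move=> a F SF; have SE : S (fscale a F) = fun x => a * S F x.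
    by apply: gstieltjesZ; exact: cB.
  have -> : l (fscale a F) = a * l F.
    by rewrite /l SE; apply/cvg_lim => //; apply: cvgMr; exact: cvgS.
  by apply/funext => x; rewrite SE /fscale; ring.
- move=> F G SF SG E; have cF := cB F SF; have cG := cB G SG.
  have S0 H : Bctau tau H -> S H 0 = 0 by move=> /B[_ H0 _]; rewrite /S gstieltjes_at0.
  (* Both transforms vanish at 0, so evaluating there isolates the subtracted limits. *)
  have lE : l F = l G by move: (congr1 (@^~ 0) E) => /=; rewrite (S0 F SF) (S0 G SG) !sub0r; exact: oppr_inj.
  rewrite -[F](gstieltjesNK (rate tau) cF) -[G](gstieltjesNK (rate tau) cG).
  congr gstieltjes; apply/funext => x.
  by move: (congr1 (@^~ x) E) => /=; rewrite lE; exact: addIr.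
- move=> G /BcP[lG G0].
  have lG' : has_limits (fun x => G x - G 0) by exact: (has_limitsB lG (has_limits_cst _)).
  have G'0 : G 0 - G 0 = 0 by rewrite subrr.
  (* The limit of [G - G 0] at minus infinity is [- G 0], so the shift in the isometry adds [G 0]
     back. *)
  exists (gstieltjes (rate tau) (fun x => G x - G 0)); split.
    by apply/B; exact: (wprim_gstieltjes _ lG' G'0).
  have SE : S (gstieltjes (rate tau) (fun x => G x - G 0)) = fun x => G x - G 0.
    by rewrite /S gstieltjesK//; exact: lG'.1.
  apply/funext => x; rewrite /l SE (_ : lim _ = 0 - G 0); first ring.
  by apply/cvg_lim => //; apply: cvgB => //; exact: cvg_cst.
- by move=> F SF; rewrite normB_shift normBtauE//; exact: cB.
Qed.

Lemma distr_mulw_Ac tau T : 0 < tau -> is_distr T ->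
  Actau tau T <-> Ac (distr_mulw T (omega tau)).
Proof.
move=> t0 dT; rewrite omegaE -/(rate tau) (ActauP _ t0) AcP; split.
  move=> [F [cF F0 lF] TF]; exists (gstieltjes (- rate tau) F); first exact: lF.
  exact: is_primitive_gauss.
move=> [G lG TG].
have lG' : has_limits (fun x => G x - G 0) by exact: (has_limitsB lG (has_limits_cst _)).
have G'0 : G 0 - G 0 = 0 by exact: subrr.
exists (gstieltjes (rate tau) (fun x => G x - G 0)).
  exact: (wprim_gstieltjes _ lG' G'0).
rewrite -[X in gstieltjes X]opprK; apply: is_primitive_gaussK; first exact: lG'.1.
exact: is_primitive_shift lG.1 TG.
Qed.

Lemma tnorm_anorm tau T : 0 < tau -> Actau tau T ->
  tnorm tau T = anorm (distr_mulw T (omega tau)).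
Proof.
move=> t0 /(ActauP _ t0)[F wF TF]; rewrite (tnormE t0 wF TF) omegaE -/(rate tau).
by case: wF => cF F0 lF; apply/esym/anormE => //; exact: is_primitive_gauss.
Qed.

Lemma Actau_add tau T U : 0 < tau -> Actau tau T -> Actau tau U -> Actau tau (distr_add T U).
Proof.
move=> t0 /(ActauP _ t0)[F wF TF] /(ActauP _ t0)[G wG UG]; apply/(ActauP _ t0).
exists (fun x => F x + G x); first exact: wprimD.
case: wF wG => cF _ _ [cG _ _] phi tp; rewrite /distr_add (TF _ tp) (UG _ tp).
exact/esym/dprimD.
Qed.

Lemma is_primitive_scale T F a : continuous F -> is_primitive T F ->
  is_primitive (distr_scale a T) (fun x => a * F x).
Proof.
by move=> cF TF phi tp; rewrite /distr_scale (TF _ tp); exact/esym/dprimZ.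
Qed.

Lemma Actau_scale tau T a : 0 < tau -> Actau tau T -> Actau tau (distr_scale a T).
Proof.
move=> t0 /(ActauP _ t0)[F wF TF]; apply/(ActauP _ t0).
exists (fun x => a * F x); first exact: wprimZ.
by apply: is_primitive_scale => //; case: wF.
Qed.

Lemma tnorm_normBtau tau T F : 0 < tau -> Bctau tau F -> is_primitive T F ->
  tnorm tau T = normBtau tau F.
Proof.
move=> t0 /(BctauP _ t0) wF TF; rewrite (tnormE t0 wF TF) normBtauE//.
by case: wF.
Qed.

Lemma is_primitive_add T U F G : continuous F -> continuous G ->
  is_primitive T F -> is_primitive U G -> is_primitive (distr_add T U) (fadd F G).
Proof.
move=> cF cG TF UG phi tp; rewrite /distr_add (TF _ tp) (UG _ tp).
exact/esym/dprimD.
Qed.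

Lemma Actau_banach tau : 0 < tau ->
  banach_space (@distr_eq R) (@distr_zero R) (@distr_add R) (@distr_scale R)
      (Actau tau) (tnorm tau).
Proof.
move=> t0; have [S0 [SD [SZ [N0 [NZ [ND C]]]]]] := Bctau_banach t0.
have cB F : Bctau tau F -> continuous F by move=> /(BctauP _ t0)[].
have P T : Actau tau T -> exists F, Bctau tau F /\ is_primitive T F by case.
have A T F : Bctau tau F -> is_primitive T F -> Actau tau T.
  by move=> /(BctauP _ t0) SF TF; apply/(ActauP _ t0); exists F.
rewrite /banach_space; split; [|split; [|split; [|split; [|split; [|split]]]]].
- apply: A S0 _ => phi tp; rewrite /distr_zero.
  by have := dprim_cst 0 tp; rewrite /dprim => ->.
- by move=> T U; exact: Actau_add.
- by move=> a T; exact: Actau_scale.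
- move=> T /P[F [SF TF]]; rewrite (tnorm_normBtau t0 SF TF).
  have [NF NF0] := N0 F SF; split=> //; rewrite NF0; split=> [F0 phi tp|T0].
    by rewrite (TF _ tp) F0; exact: dprim_cst.
  have Z0 : is_primitive T (fun=> 0).
    by move=> phi tp; rewrite (T0 _ tp); exact/esym/dprim_cst.
  apply: (wprim_unique (c := rate tau) _ _ TF Z0); first exact/BctauP.
  exact/BctauP.
- move=> a T /P[F [SF TF]].
  rewrite (tnorm_normBtau t0 SF TF) -NZ//.
  exact: (tnorm_normBtau t0 (SZ a F SF) (is_primitive_scale a (cB _ SF) TF)).
- move=> T U /P[F [SF TF]] /P[G [SG UG]].
  rewrite (tnorm_normBtau t0 SF TF) (tnorm_normBtau t0 SG UG).
  rewrite (tnorm_normBtau t0 (SD F G SF SG) (is_primitive_add (cB _ SF) (cB _ SG) TF UG)).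
  exact: ND.
(* Completeness is inherited: primitives are chosen along the sequence, and the limit is the
   distributional derivative of their limit. *)
- move=> u Su uC; have [v Hv] := choice (fun n => P (u n) (Su n)).
  have [|e e0|F [SF HF]] := C v.
  + by move=> n; case: (Hv n).
  + have [M HM] := uC e e0; exists M => m n Mm Mn.
    have [Sm Pm] := Hv m; have [Sn Pn] := Hv n.
    have := HM m n Mm Mn; rewrite (tnorm_normBtau t0 (SD _ _ Sm (SZ (-1) _ Sn)))//.
    apply: is_primitive_add => //; [exact: cB|exact/cB/SZ|].
    exact: (is_primitive_scale (-1) (cB _ Sn) Pn).
  have PF : is_primitive (dprim F) F by [].
  exists (dprim F); split; first exact: A SF PF.
  move=> e /HF[M HM]; exists M => n Mn; have [Sn Pn] := Hv n.
  rewrite (tnorm_normBtau t0 (SD _ _ Sn (SZ (-1) _ SF))); first exact: HM.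
  apply: is_primitive_add => //; [exact: cB|exact/cB/SZ|].
  exact: (is_primitive_scale (-1) (cB _ SF) PF).
Qed.

Lemma Actau_isometry tau : 0 < tau ->
  isometrically_isomorphic
      (@distr_eq R) (@distr_add R) (@distr_scale R) (Actau tau) (tnorm tau)
      (@distr_eq R) (@distr_add R) (@distr_scale R) (@Ac R) (@anorm R).
Proof.
move=> t0; exists (fun T => distr_mulw T (omega tau)).
(* Gaussians are invertible multipliers of test functions, so a distribution is determined by its
   product with [omega tau]. *)
have gK c phi : (fun x => gauss c x * (gauss (- c) x * phi x)) = phi.
  by apply/funext => x; rewrite mulrA gaussD addrN /gauss mul0r expR0 mul1r.
split; [|split; [|split; [|split; [|split; [|split]]]]].
- by move=> T AT; apply/distr_mulw_Ac => //; case: AT.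
- move=> T U _ TU phi tp; rewrite /distr_mulw omegaE; apply: TU.
  exact: test_fun_gauss.
- by [].
- by [].
- move=> T U _ _ TU phi tp; have := TU _ (test_fun_gauss (rate tau) tp).
  rewrite /distr_mulw omegaE -/(rate tau).
  by have := gK (- rate tau) phi; rewrite opprK => ->.
- move=> U /AcP[G lG UG].
  have lG' : has_limits (fun x => G x - G 0) by exact: (has_limitsB lG (has_limits_cst _)).
  have G'0 : G 0 - G 0 = 0 by exact: subrr.
  have wG := wprim_gstieltjes (rate tau) lG' G'0.
  exists (dprim (gstieltjes (rate tau) (fun x => G x - G 0))).
  split; first by apply/(ActauP _ t0); eexists; [exact: wG|].
  move=> phi tp; rewrite /distr_mulw omegaE -/(rate tau).
  rewrite -(dprim_gstieltjes _ _ tp); last by case: wG.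
  rewrite gstieltjesK; last exact: lG'.1.
  exact/esym/(is_primitive_shift (G 0) lG.1 UG tp).
- by move=> T AT; rewrite tnorm_anorm.
Qed.

(** * Comparison of different exponents *)

Lemma wprim_le c d F : c <= d -> wprim c F -> wprim d F.
Proof.
move=> cd [cF F0 lF]; split; [exact: cF|exact: F0|].
(* The group law factors the transform for [d] through the one for [c]; the remaining exponent
   [c - d] is at most 0 and so preserves limits. *)
have -> : gstieltjes (- d) F = gstieltjes (c - d) (gstieltjes (- c) F).
  by rewrite (gstieltjes_comp _ _ cF) (_ : c - d + - c = - d); last by ring.
by apply: gstieltjes_has_limits lF; lra.
Qed.

Lemma Ac_Actau tau T : 0 < tau -> Ac T -> Actau tau T.
Proof.
move=> t0 /AcP[G lG TG]; apply/(ActauP _ t0); exists (fun x => G x - G 0).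
  have lG' : has_limits (fun x => G x - G 0) by exact: (has_limitsB lG (has_limits_cst _)).
  apply: (wprim_le (ltW (rate_gt0 t0))); split; [exact: lG'.1|exact: subrr|].
  by rewrite oppr0 gstieltjes_id; exact: lG'.
exact: is_primitive_shift lG.1 TG.
Qed.

Lemma Actau_le r s T : 0 < r -> r <= s -> Actau s T -> Actau r T.
Proof.
move=> r0 rs; have s0 : 0 < s by lra.
move=> /(ActauP _ s0)[F wF TF]; apply/(ActauP _ r0); exists F; last exact: TF.
apply: wprim_le wF; move: rs; rewrite le_eqVlt => /predU1P[->//|rs].
exact/ltW/rate_lt.
Qed.

Lemma square_no_limits : ~ has_limits (fun x : R => x ^+ 2).
Proof.
move=> /has_limits_bounded[K K0 /(_ (K + 1))].
by rewrite ger0_norm ?sqr_ge0//; nra.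
Qed.

(* The weighted Stieltjes primitive of [x^2] against [exp (- delta x^2)] is
   [(1 - exp (- delta x^2)) / delta], which has limits although [x^2] does not. *)
Lemma wprim_strict c d : c < d ->
  exists F, [/\ wprim d F, continuous (gstieltjes (- c) F) & ~ has_limits (gstieltjes (- c) F)].
Proof.
move=> cd; pose sq (x : R) := x ^+ 2.
have sqD x : is_derive x (1 : R) sq (2 * x).
  by apply: (is_derive_eq (is_derive_pM (is_derive_pX x) (is_derive_pX x))); ring.
have csq : continuous sq by exact: is_derive_continuous sqD.
have c2 : continuous (fun x : R => 2 * x).
  by apply: continuous_pZ => x; exact: cvg_id.
(* Prescribing the transform at exponent [- c] to be [x^2] rules out limits there; at exponent [- d]
   the net weight has exponent [k = c - d < 0]. *)
exists (gstieltjes c sq); rewrite (gstieltjesK c csq).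
split; [|exact: csq|exact: square_no_limits].
split; first exact: gstieltjes_cont.
  by rewrite gstieltjes_at0 /sq expr0n.
rewrite (gstieltjes_comp _ _ csq); set k := - d + c.
have k0 : k < 0 by rewrite /k; lra.
move: k k0 => k k0 {cd c d}.
have PD x : is_derive x (1 : R) (fun x => k^-1 * gauss k x) (2 * x * gauss k x).
  apply: (is_derive_eq (is_derive_pZ _ ((gauss_weight k).1 x))).
  by rewrite /dgauss; field; rewrite lt_eqF.
have E x : gstieltjes k sq x = k^-1 * gauss k x - k^-1.
  have := gstieltjes_antideriv 0 x c2 sqD PD.
  by rewrite gstieltjes_at0 gauss0 mulr1 /sq expr0n/= subr0.
split; first exact: gstieltjes_cont.
suff A e : 0 < e -> exists2 M, 0 <= M & forall x y, M <= `|x| -> M <= `|y| ->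
    `|gstieltjes k sq x - gstieltjes k sq y| <= e.
  move=> e /A[M M0 HM]; exists M => //; split=> x y Mx My; apply: HM.
  - exact: le_trans Mx (ler_norm _).
  - exact: le_trans My (ler_norm _).
  - by rewrite -normrN (le_trans _ (ler_norm _))//; lra.
  - by rewrite -normrN (le_trans _ (ler_norm _))//; lra.
move=> e0; have nk : 0 < - k by lra.
have ke : 0 < - k * e by rewrite mulr_gt0.
(* Beyond [M] this makes [gauss k] at most [- k e], which absorbs the factor [k^-1] in [E]. *)
have [M M0 HM] := gauss_large (- k * e)^-1 nk; exists M => // x y /HM gx /HM gy.
have small z : (- k * e)^-1 <= gauss (- k) z -> 0 <= gauss k z <= - k * e.
  move=> gz; rewrite ltW ?gauss_gt0//=.
  have -> : gauss k z = (gauss (- k) z)^-1 by rewrite /gauss -expRN mulNr opprK.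
  by rewrite -(invrK (- k * e)) lef_pV2 ?posrE ?gauss_gt0// invr_gt0.
have /andP[x1 x2] := small _ gx; have /andP[y1 y2] := small _ gy.
rewrite !E (_ : _ - _ = k^-1 * (gauss k x - gauss k y)); last by ring.
rewrite normrM normfV (ltr0_norm k0) mulrC ler_pdivrMr// mulrC ler_norml.
lra.
Qed.

Lemma Actau_strict r s : 0 < r -> r < s -> exists T, Actau r T /\ ~ Actau s T.
Proof.
move=> r0 rs; have s0 : 0 < s by lra.
have [F [wF _ nF]] := wprim_strict (rate_lt r0 rs); have [cF F0 _] := wF.
exists (dprim F); split; first by apply/(ActauP _ r0); exists F.
move=> /(ActauP _ s0)[G [cG G0 lG] TG]; apply: nF.
suff -> : F = G by [].
apply/funext => x; have := @is_primitive_unique (dprim F) F G cF cG _ TG x 0.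
by rewrite F0 G0 !subr0; exact.
Qed.

Lemma Actau_strict_Ac tau : 0 < tau -> exists T, Actau tau T /\ ~ Ac T.
Proof.
move=> t0; have [F [wF _ nF]] := wprim_strict (rate_gt0 t0); have [cF F0 _] := wF.
exists (dprim F); split; first by apply/(ActauP _ t0); exists F.
move=> /AcP[G lG TG]; apply: nF; rewrite oppr0 gstieltjes_id.
suff -> : F = fun x => G x - G 0 by exact: (has_limitsB lG (has_limits_cst _)).
apply/funext => x; have := @is_primitive_unique (dprim F) F G cF lG.1 _ TG x 0.
by rewrite F0 !subr0; exact.
Qed.

Lemma Actau_strict_iff r s : 0 < r -> 0 < s ->
  r < s <-> ((forall T, Actau s T -> Actau r T) /\ (exists T, Actau r T /\ ~ Actau s T)).
Proof.
move=> r0 s0; split=> [rs|[_ [T [rT nsT]]]].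
  by split; [move=> T; apply: Actau_le => //; exact: ltW|exact: Actau_strict].
by rewrite ltNge; apply/negP => sr; apply: nsT; exact: Actau_le rT.
Qed.

(** * Growth, density and comparison of norms *)

Lemma Bctau_growth tau T F : 0 < tau -> Bctau tau F -> is_primitive T F ->
  (forall x, `|F x| <= tnorm tau T * expR (x ^+ 2 / (4 * tau))) /\
  (F x / expR (x ^+ 2 / (4 * tau)) @[x --> +oo] --> 0) /\
  (F x / expR (x ^+ 2 / (4 * tau)) @[x --> -oo] --> 0).
Proof.
move=> t0 /(BctauP _ t0) wF TF; rewrite (tnormE t0 wF TF); have [cF F0 lF] := wF.
have gE : (fun x => expR (x ^+ 2 / (4 * tau))) = gauss (rate tau).
  by apply/funext => x; rewrite /gauss mulrC.
have FE : F = gstieltjes (rate tau) (gstieltjes (- rate tau) F) by rewrite gstieltjesNK.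
have k0 := rate_gt0 t0; split.
  move=> x; rewrite [X in _ * X](congr1 (@^~ x) gE) [in X in X <= _]FE.
  by apply: gstieltjes_growth => //; [exact: ltW|rewrite gstieltjes_at0].
have := gstieltjes_littleo k0 lF; rewrite -FE -gE; exact.
Qed.

(** Where [G] is constant, [dG] vanishes and even a growing weight contributes nothing. This permits
    the positive exponent [rate r - rate s] that density requires. *)
Lemma gstieltjes_flat c G M : 0 <= M -> continuous G ->
  (forall x, M <= x -> G x = G M) -> (forall x, x <= - M -> G x = G (- M)) ->
  has_limits (gstieltjes c G).
Proof.
move=> M0 cG R1 R2; apply: (has_limits_flat M0).
- exact: gstieltjes_cont.
- move=> x Mx; apply: gstieltjes_const => //.
  by move=> t Mt _; exact: R1.
- move=> x Mx; apply/esym; apply: gstieltjes_const => //.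
  by move=> t xt tM; rewrite (R2 t)// (R2 x).
Qed.

Lemma Actau_dense r s T e : 0 < r -> r < s -> Actau r T -> 0 < e ->
  exists U, Actau s U /\ tnorm r (distr_add T (distr_scale (-1) U)) < e.
Proof.
move=> r0 rs /(ActauP _ r0)[F wF TF] e0; have s0 : 0 < s by lra.
have [cF F0 lF] := wF; set G := gstieltjes (- rate r) F in lF.
have e4 : 0 < e / 4 by lra.
have [M M0 HM] := clip_approx lF e4.
(* A uniform error of [e / 4] becomes an oscillation of at most [e / 2], which is below [e]. *)
pose G' x := G (clip M x).
have G'0 : G' 0 = 0 by rewrite /G' clip_mid; [rewrite /G gstieltjes_at0|lra|lra].
have cG' : continuous G' by apply: continuous_pcomp lF.1 _; exact: clip_cont.
have R1 x : M <= x -> G' x = G' M by move=> Mx; rewrite /G' !clip_right.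
have R2 x : x <= - M -> G' x = G' (- M) by move=> Mx; rewrite /G' !clip_left.
have lG' : has_limits G' by exact: (has_limits_flat M0).
have wF' := wprim_gstieltjes (rate r) lG' G'0; have [cF' F'0 _] := wF'.
exists (dprim (gstieltjes (rate r) G')); split.
  apply/(ActauP _ s0); exists (gstieltjes (rate r) G'); last by [].
  split; [exact: cF'|exact: F'0|].
  rewrite (gstieltjes_comp _ _ cG'); exact: (gstieltjes_flat _ M0 cG' R1 R2).
have P : is_primitive (dprim (gstieltjes (rate r) G')) (gstieltjes (rate r) G') by [].
rewrite (tnormE r0 (wprim_lin (-1) wF wF') (is_primitive_lin (-1) cF cF' TF P)).
rewrite (gstieltjes_lin _ _ cF cF') (gstieltjesK _ cG').
rewrite (_ : (fun x => _) = fun x => G x - G' x); last by apply/funext => x; rewrite mulN1r.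
rewrite (le_lt_trans (normB_dist_le HM))//; lra.
Qed.

Lemma tnorm_le r s T : 0 < r -> r < s -> Actau s T -> tnorm r T <= 2 * tnorm s T.
Proof.
move=> r0 rs; have s0 : 0 < s by lra.
move=> /(ActauP _ s0)[F wF TF]; have krs := rate_lt r0 rs.
rewrite (tnormE s0 wF TF) (tnormE r0 (wprim_le (ltW krs) wF) TF).
have [cF F0 lF] := wF.
have -> : gstieltjes (- rate r) F = gstieltjes (rate s - rate r) (gstieltjes (- rate s) F).
  by rewrite (gstieltjes_comp _ _ cF) (_ : rate s - rate r + - rate s = - rate r); last by ring.
by apply: normB_gstieltjes lF; lra.
Qed.

End Spaces.

(** * Weighted integrable functions *)

Section WeightedL1.
Variable R : realType.
Local Notation mu := (@lebesgue_measure R).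
Implicit Types (f g h P Q F G H S w dw phi psi : R -> R) (a b c d e x y K M tau r s : R) (n : nat).
Implicit Types (T U : (R -> R) -> R).

Definition integrable_on_segments f := forall a b, mu.-integrable `[a, b] (EFin \o f).

Lemma continuous_segment_bounded h a b : a <= b -> continuous h ->
  exists2 K, 0 <= K & forall x, a <= x -> x <= b -> `|h x| <= K.
Proof.
move=> ab ch; have [|c _ Hc] := @EVT_max R (fun x => `|h x|) a b ab.
  apply: continuous_subspaceT => x; apply: continuous_comp; first exact: ch.
  exact: norm_continuous.
by exists `|h c| => // x ax xb; apply: Hc; rewrite in_itv/= ax.
Qed.

Lemma integrable_mulr_continuous f w : continuous w -> integrable_on_segments f ->
  integrable_on_segments (fun x => f x * w x).
Proof.
move=> cw fi a b; have [ab|ba] := leP a b; last first.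
  by rewrite set_itv_ge ?bnd_simp -?ltNge//; exact: integrable_set0.
have [K K0 HK] := continuous_segment_bounded ab cw.
have := @integrableMl _ _ _ mu `[a, b]%classic (measurable_itv _) (EFin \o f) w (fi a b).
rewrite (_ : ((EFin \o f) \* (EFin \o w))%E = EFin \o (fun x => f x * w x)); last first.
  by apply/funext => x; rewrite /= EFinM.
apply; first by apply: measurable_funTS; exact: continuous_measurable_fun.
exists K; split; first exact: num_real.
move=> M KM x /=; rewrite in_itv/= => /andP[ax xb].
by rewrite (le_trans (HK x ax xb))// ltW.
Qed.

Lemma ointB_seg f a b : a <= b -> integrable_on_segments f ->
  oint 0 b f - oint 0 a f = \int[mu]_(x in `[a, b]) f x.
Proof. by move=> ab fi; apply: ointB. Qed.

Lemma continuous_integrable_on_segments h : continuous h -> integrable_on_segments h.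
Proof. by move=> ch a b; exact: continuous_itv_integrable. Qed.

Lemma oint_continuous f : integrable_on_segments f -> continuous (fun x => oint 0 x f).
Proof.
move=> fi x; have lt1 : x - 1 < x + 1 by lra.
have := parameterized_integral_continuous (ltW lt1) (fi (x - 1) (x + 1)).
move=> /(continuous_within_itvP _ lt1)[+ _ _].
have xin : x \in `]x - 1, x + 1[ by rewrite in_itv/=; lra.
move=> /(_ x xin) cx.
have E z : x - 1 <= z ->
    oint 0 z f = parameterized_integral mu (x - 1) z f + oint 0 (x - 1) f.
  by move=> xz; rewrite /parameterized_integral -ointB_seg// subrK.
apply/cvgrPdist_le => e e0; move/cvgrPdist_le/(_ e e0) : cx => cx.
near=> y; rewrite (E x) ?(E y); [|by apply: ltW; near: y; apply: lt_nbhsr; lra|lra].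
by rewrite opprD addrACA subrr addr0; near: y.
Unshelve. all: by end_near. Qed.

Lemma integrable_on_segmentsB f g : integrable_on_segments f -> integrable_on_segments g ->
  integrable_on_segments (fun x => f x - g x).
Proof.
move=> fi gi a b; have := @integrableB _ _ _ mu `[a, b]%classic (measurable_itv _) _ _ (fi a b) (gi a b).
by rewrite (_ : (EFin \o f \- (EFin \o g))%E = EFin \o (fun x => f x - g x)).
Qed.

Lemma Rintegral_segment_mono h a b c d : integrable_on_segments h ->
  (forall x, 0 <= h x) -> a <= b -> b <= c -> c <= d ->
  \int[mu]_(x in `[b, c]) h x <= \int[mu]_(x in `[a, d]) h x.
Proof.
move=> hi h0 ab bc cd.
rewrite (@Rintegral_itv_split _ _ a b d)//; last lra.
rewrite (@Rintegral_itv_split _ _ b c d)//.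
have i1 : 0 <= \int[mu]_(x in `[a, b]) h x by apply: Rintegral_ge0.
have i2 : 0 <= \int[mu]_(x in `[c, d]) h x by apply: Rintegral_ge0.
by rewrite addrCA lerDl addr_ge0.
Qed.

Lemma integrable_on_segments_norm f : integrable_on_segments f ->
  integrable_on_segments (fun x => `|f x|).
Proof. by move=> fi a b; exact: (integrable_norm (fi a b)). Qed.

Lemma le_normr_segment f a b : integrable_on_segments f ->
  `|\int[mu]_(x in `[a, b]) f x| <= \int[mu]_(x in `[a, b]) `|f x|.
Proof. by move=> fi; apply: le_normr_Rintegral; [exact: measurable_itv|exact: fi]. Qed.

Lemma L1_approx f a b e : integrable_on_segments f -> 0 < e ->
  exists2 g, continuous g & \int[mu]_(x in `[a, b]) `|f x - g x| < e.
Proof.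
move=> fi e0.
have fin : (mu `[a, b]%classic < +oo)%E by rewrite lebesgue_measure_itv/=; case: ifP => //; rewrite ltry.
have [g_ [cg _ /fine_cvgP[_ /cvgrPdist_lt/(_ e e0)[N _ HN]]]] :=
  approximation_continuous_integrable (measurable_itv _) fin (fi a b).
exists (g_ N); first exact: cg.
have := HN N (leqnn _); rewrite /= sub0r normrN ger0_norm//.
by apply: fine_ge0; apply: integral_ge0 => x _; rewrite lee_fin.
Qed.

(* Both sides are continuous in [f] for the L^1 norm and agree for continuous [f]. *)
Lemma stieltjes_oint w dw f a b : weight w dw -> integrable_on_segments f -> a <= b ->
  stieltjes w dw (fun x => oint 0 x f) b - stieltjes w dw (fun x => oint 0 x f) a =
  \int[mu]_(x in `[a, b]) (f x * w x).
Proof.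
move=> W fi ab; have cw := weight_cont W.
have [A A0 HA] := continuous_segment_bounded ab cw.
have [B B0 HB] := continuous_segment_bounded ab W.2.
have cF := oint_continuous fi; set F := fun x => oint 0 x f in cF *.
apply/eqP; rewrite -subr_eq0 -normr_le0; apply/ler_addgt0Pr => e e0; rewrite add0r.
(* The three terms multiply the L^1 error in the boundary term, in the integral against [dw], and in
   the integral of [f w]; the final 1 makes [C] positive. *)
pose C := A + B * (b - a) + A + 1.
have C0 : 0 < C by have := mulr_ge0 B0 (_ : 0 <= b - a); rewrite subr_ge0 => /(_ ab); rewrite /C; lra.
have [g cg] := L1_approx a b fi (divr_gt0 e0 C0).
set eta := \int[mu]_(x in _) _ => eta_small.
have gi := continuous_integrable_on_segments cg.
have cG := oint_continuous gi; set G := fun x => oint 0 x g in cG.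
have fgi := integrable_on_segmentsB fi gi.
have Eg : stieltjes w dw G b - stieltjes w dw G a = \int[mu]_(x in `[a, b]) (g x * w x).
  have cgw := continuous_pM cg cw.
  have GD x := is_derive_oint x cg; have PD x := is_derive_oint x cgw.
  by rewrite (stieltjes_antideriv a b W cg GD PD) ointB_cont.
(* The primitive of the error [f - g]: on [[a, b]] it moves by at most the L^1 error [eta], which is
   all that the by-parts formula sees. *)
pose D x := F x + -1 * G x.
have cD : continuous D by apply: continuous_pD => //; exact: continuous_pZ.
have SD x : stieltjes w dw D x = stieltjes w dw F x - stieltjes w dw G x.
  by have := congr1 (fun u => u x) (stieltjes_lin (-1) W cF cG); rewrite /= mulN1r.
have HD x : a <= x -> x <= b -> `|D x - D a| <= eta.
  move=> ax xb; have -> : D x - D a = \int[mu]_(t in `[a, x]) (f t - g t).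
    rewrite RintegralB; [|exact: measurable_itv|exact: fi|exact: gi].
    by rewrite -!ointB_seg// /D /F /G mulN1r mulN1r; lra.
  rewrite (le_trans (le_normr_segment _ _ fgi))//.
  by apply: Rintegral_segment_mono => //; exact: integrable_on_segments_norm.
have eta0 : 0 <= eta by rewrite (le_trans _ (HD a (lexx _) ab)).
have E1 : `|stieltjes w dw D b - stieltjes w dw D a| <= eta * A + eta * B * (b - a).
  rewrite (stieltjes_incr (D a) a b W cD) subrr mul0r subr0.
  rewrite (le_trans (ler_normB _ _))// lerD//.
    by rewrite normrM ler_pM// ?HD// HA.
  have cDw : continuous (fun t => (D t - D a) * dw t).
    by apply: continuous_pM W.2; apply: continuous_pB => // z; exact: cvg_cst.
  rewrite mulrBr; apply: (@oint_le_weight _ _ (fun=> eta * B) (fun x => eta * B * x) _ _ ab cDw).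
    move=> x; apply: (is_derive_eq (is_derive_pZ _ (is_derive_pX x))).
    by rewrite mulr1.
  by move=> x ax xb; rewrite normrM ler_pM// ?HD// HB.
have E2 : `|\int[mu]_(x in `[a, b]) (f x * w x) - \int[mu]_(x in `[a, b]) (g x * w x)| <= eta * A.
  have fwi := integrable_mulr_continuous cw fi; have gwi := integrable_mulr_continuous cw gi.
  rewrite -RintegralB; [|exact: measurable_itv|exact: fwi|exact: gwi].
  rewrite (le_trans (le_normr_segment _ _ (integrable_on_segmentsB fwi gwi)))//.
  have ni := integrable_on_segments_norm fgi.
  rewrite mulrC -RintegralZl; [|exact: measurable_itv|exact: ni].
  apply: le_Rintegral; [exact: measurable_itv| | |].
  - exact: (integrable_on_segments_norm (integrable_on_segmentsB fwi gwi)).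
  - have := integrable_mulr_continuous (w := fun=> A) _ ni a b.
    rewrite (_ : (fun x => `|f x - g x| * A) = (fun x => A * `|f x - g x|)); last first.
      by apply/funext => x; exact: mulrC.
    by apply=> x; exact: cvg_cst.
  - move=> x /=; rewrite in_itv/= => /andP[ax xb].
    by rewrite -mulrBl normrM mulrC ler_wpM2r// HA.
rewrite (_ : _ - _ = (stieltjes w dw D b - stieltjes w dw D a)
  - (\int[mu]_(x in `[a, b]) (f x * w x) - \int[mu]_(x in `[a, b]) (g x * w x))); last first.
  have alg (p q i u v : R) : p - q - i = (p - u) - (q - v) - (i - (u - v)) by ring.
  by rewrite !SD -Eg; exact: alg.
rewrite (le_trans (ler_normB _ _))// (le_trans (lerD E1 E2))//.
have : eta * C <= e by rewrite -ler_pdivlMr// ltW.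
by rewrite /C; lra.
Qed.

(** A test function is itself an admissible weight, so the Stieltjes formula with [w = phi] is the
    required integration by parts; the boundary terms vanish off the support. *)
Lemma is_primitive_oint f : integrable_on_segments f ->
  is_primitive (distr_of_fun f) (fun x => oint 0 x f).
Proof.
move=> fi phi tp; rewrite /distr_of_fun; have cF := oint_continuous fi.
have [M M0 [HM HM1]] := test_fun_supp tp.
have M1 : 0 <= M + 1 by lra.
have MM : - (M + 1) <= M + 1 by lra.
have W : weight phi (derive1 phi).
  by split=> [x|]; [exact: test_fun_derive|exact: test_fun_cont1].
have s1 x : f x * phi x != 0 -> - (M + 1) <= x <= M + 1.
  by rewrite mulf_eq0 negb_or => /andP[_ /HM]; lra.
have s2 x : oint 0 x f * derive1 phi x != 0 -> - (M + 1) <= x <= M + 1.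
  by rewrite mulf_eq0 negb_or => /andP[_ /HM1]; lra.
have p0 x : ~~ (- M <= x <= M) -> phi x = 0.
  by move=> xM; apply/eqP; apply: contraNT xM; exact: HM.
rewrite (RintegralT_supp s1) -(stieltjes_oint W fi MM).
rewrite (RintegralT_oint M1 (continuous_pM cF W.2) s2) /stieltjes.
by rewrite !p0 ?mulr0 ?sub0r; [ring|apply/negP; lra|apply/negP; lra].
Qed.

(** The hypothesis makes [Q] nondecreasing, and it is bounded. Past a point where [Q] is within [e]
    of its supremum, or before one where it is within [e] of its infimum, [S] has no room to move by
    more than [e]. *)
Lemma osc_vanishes_dominated S Q K : (forall x y, x <= y -> `|S y - S x| <= Q y - Q x) ->
  (forall x, `|Q x| <= K) -> osc_vanishes S.
Proof.
move=> SQ QK e e0.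
have ndQ x y : x <= y -> Q x <= Q y.
  by move=> xy; have := SQ x y xy; have := normr_ge0 (S y - S x); lra.
have hs : has_sup (range Q).
  split; first by exists (Q 0), 0.
  by exists K => _ [x _ <-]; rewrite (le_trans (ler_norm _)).
have hi : has_inf (range Q).
  split; first by exists (Q 0), 0.
  by exists (- K) => _ [x _ <-]; have := QK x; rewrite ler_norml => /andP[].
have [_ [p _ <-] Hp] := sup_adherent e0 hs.
have [_ [q _ <-] Hq] := inf_adherent e0 hi.
have Qs x : Q x <= sup (range Q) by apply: ub_le_sup; [exact: hs.2|exists x].
have Qi x : inf (range Q) <= Q x by apply: ge_inf; [exact: hi.2|exists x].
have A x y : p <= x -> x <= y -> `|S y - S x| <= e.
  by move=> px xy; have := SQ x y xy; have := Qs y; have := ndQ p x px; lra.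
have B x y : y <= q -> x <= y -> `|S y - S x| <= e.
  by move=> px xy; have := SQ x y xy; have := Qi x; have := ndQ y q px; lra.
exists (`|p| + `|q|); first by rewrite addr_ge0.
have bp := ler_norm p; have bq := ler_norm (- q); rewrite normrN in bq.
have n1 := normr_ge0 p; have n2 := normr_ge0 q.
split=> x y Mx My; have [xy|/ltW xy] := leP x y.
- by rewrite distrC; apply: A => //; lra.
- by apply: A => //; lra.
- by rewrite distrC; apply: B => //; lra.
- by apply: B => //; lra.
Qed.

Lemma L1w_integrable_on_segments tau f : L1w tau f -> integrable_on_segments f.
Proof.
move=> [[mf _ Hf] _] a b; apply/integrableP; split.
  apply/measurable_EFinP; exact: measurable_funTS.
by apply: Hf => //; exact: segment_compact.
Qed.

(** Increments of the transform are integrals of [f omega]. They are dominated by those of the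
    primitive of [|f omega|], which is bounded by the total integral. *)
Lemma L1w_wprim tau f : 0 < tau -> L1w tau f -> wprim (rate tau) (fun x => oint 0 x f).
Proof.
move=> t0 Lf; have fi := L1w_integrable_on_segments Lf; have cF := oint_continuous fi.
have [_ gi] := Lf; rewrite omegaE -/(rate tau) in gi.
set k := - rate tau in gi *; have W := gauss_weight k.
pose g x := f x * gauss k x.
have gs : integrable_on_segments g by exact: integrable_mulr_continuous (weight_cont W) fi.
have ns := integrable_on_segments_norm gs.
split; [exact: cF|exact: oint0|split; first exact: gstieltjes_cont].
apply: (@osc_vanishes_dominated _ (fun x => oint 0 x (fun t => `|g t|)) (\int[mu]_x `|g x|)).
  move=> x y xy; rewrite /gstieltjes (stieltjes_oint W fi xy) (ointB_seg xy ns).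
  exact: (le_normr_segment x y gs).
have le_total a b : `|\int[mu]_(x in `[a, b]) `|g x| | <= \int[mu]_x `|g x|.
  rewrite ger0_norm; last by apply: Rintegral_ge0.
  have ni := integrable_norm gi.
  rewrite /Rintegral fine_le//.
  - exact: (integrable_fin_num _ (ns a b)).
  - exact: (integrable_fin_num _ ni).
  - apply: ge0_subset_integral => //.
    by case/integrableP: ni.
by move=> x; rewrite /oint; case: ifP => _; rewrite ?normrN; exact: le_total.
Qed.

Lemma L1w_Actau tau f : 0 < tau -> L1w tau f -> Actau tau (distr_of_fun f).
Proof.
move=> t0 Lf; apply/(ActauP _ t0); exists (fun x => oint 0 x f); first exact: L1w_wprim.
exact/is_primitive_oint/L1w_integrable_on_segments/Lf.
Qed.

(** * Density of the weighted integrable functions *)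

Lemma continuous_supp_integrable h a b : continuous h ->
  (forall x, h x != 0 -> a <= x <= b) -> mu.-integrable [set: R] (EFin \o h).
Proof.
move=> ch hab.
have -> : EFin \o h = (EFin \o h) \_ `[a, b].
  apply/funext => x; rewrite patchE; case: ifPn => //; rewrite notin_setE/= in_itv/= => /negP xab.
  by congr EFin; apply/eqP; apply: contraNT xab => /hab.
by apply: (integrable_mkcond _ _).1; [exact: measurable_itv|exact: continuous_itv_integrable].
Qed.

Lemma continuous_supp_L1w tau g a b : 0 < tau -> continuous g ->
  (forall x, g x != 0 -> a <= x <= b) -> L1w tau (fun x => g x * gauss (rate tau) x).
Proof.
move=> t0 cg gab; have cw c := weight_cont (@gauss_weight R c).
have s x : g x * gauss (rate tau) x != 0 -> a <= x <= b.
  by rewrite mulf_eq0 negb_or => /andP[/gab].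
split.
  apply: open_integrable_locally; first exact: openT.
  exact: continuous_supp_integrable (continuous_pM cg (cw _)) s.
rewrite (_ : (fun x => _) = g); first exact: continuous_supp_integrable cg gab.
apply/funext => x; rewrite omegaE -/(rate tau) -mulrA gaussD addrN.
by rewrite /gauss mul0r expR0 mulr1.
Qed.

Lemma uniform_continuity_segment G a b e : continuous G -> 0 < e ->
  exists2 d, 0 < d & forall x y, a <= x <= b -> `|x - y| < d -> `|G x - G y| <= e.
Proof.
move=> /continuous_epsP cG e0; have e2 : 0 < e / 2 by lra.
(* Compactness in covering form: a property valid near each point of the segment for all small radii
   is valid on the whole segment with a common radius. *)
have /compact_near_coveringP/near_covering_withinP cov := @segment_compact R a b.
have [|d /= d0 Hd] := cov R (0^'+) (fun d x => forall y, `|x - y| < d -> `|G x - G y| <= e) _.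
  move=> x _; have [d d0 Hd] := cG x _ e2; have d2 : 0 < d / 2 by lra.
  have tri (u v z h : R) : `|u - v| < d / 2 -> `|v - z| < h -> h < d / 2 -> `|u - z| < d.
    by move=> uv vz hd; rewrite (le_lt_trans (ler_distD v _ _))//; lra.
  have xd (u v : R) : `|u - v| < d / 2 -> `|u - v| < d by lra.
  near=> x' h => _ y xy.
  have h1 : h < d / 2 by near: h; exact: nbhs_right_lt.
  have x1 : `|x - x'| < d / 2.
    by near: x'; apply/nbhs_ballP; exists (d / 2).
  have yx : `|x - y| < d by exact: tri x1 xy h1.
  rewrite (le_trans (ler_distD (G x) _ _))// distrC.
  by rewrite (le_trans (lerD (Hd x' (xd x x' x1)) (Hd y yx)))// -splitr.
have dd : 0 < d / 2 by lra.
exists (d / 2) => // x y xab xy.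
have := Hd (d / 2); rewrite /= sub0r normrN gtr0_norm// => /(_ ltac:(lra) dd x).
by apply => //=; rewrite in_itv.
Unshelve. all: by end_near. Qed.

(** Clipping does not separate points, so uniform continuity on [[- M, M]] passes to the clipped
    function on the whole line. *)
Lemma clip_lipschitz M x y : `|clip M x - clip M y| <= `|x - y|.
Proof.
wlog xy : x y / x <= y.
  by move=> W; have [/W//|/ltW/W] := leP x y; rewrite distrC (distrC y).
rewrite (distrC x) (ger0_norm (_ : 0 <= y - x)) ?subr_ge0// ler_norml.
by rewrite /clip /Num.max /Num.min; do !case: ifPn; rewrite -?leNgt; lra.
Qed.

(* Clipping makes [G] constant near infinity, and then a Steklov average
   [h^-1 * \int_x^(x+h)] gives a C^1 function. *)
Lemma smooth_approx G e : has_limits G -> 0 < e ->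
  exists H h M, [/\ continuous h, forall x, is_derive x 1 H (h x),
    forall x, h x != 0 -> - M <= x <= M & forall x, `|G x - H x| <= e].
Proof.
move=> lG e0; have e2 : 0 < e / 2 by lra.
have [M M0 HM] := clip_approx lG e2.
have [d d0 Hd] := uniform_continuity_segment (- M) M lG.1 e2.
pose C x := G (clip M x).
have cC : continuous C by apply: continuous_pcomp lG.1 _; exact: clip_cont.
pose s := d / 2; have s0 : 0 < s by rewrite /s; lra.
pose J x := oint 0 x C.
have JD x : is_derive x (1 : R) J (C x) by exact: is_derive_oint.
have sn0 : s != 0 by rewrite gt_eqF.
exists (fun x => s^-1 * (J (x + s) - J x)), (fun x => s^-1 * (C (x + s) - C x)), (M + s); split.
- apply: continuous_pZ; apply: continuous_pB => //; apply: continuous_pcomp => // x.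
  by apply: cvgD; [exact: cvg_id|exact: cvg_cst].
- move=> x; apply: is_derive_pZ; apply: is_derive_pB => //.
  apply: (is_derive_eq (@is_derive_pcomp _ J (fun x => x + s) x _ _ (JD (x + s))
    (is_derive_pD (is_derive_pX x) (is_derive_p1 s x)))).
  by rewrite addr0 mul1r.
- move=> x; apply: contraNT; rewrite negb_and -!ltNge => xM.
  rewrite mulf_eq0 subr_eq0; apply/orP; right; apply/eqP; rewrite /C.
  have [x0|x0] := leP 0 x; first by rewrite !clip_right//; lra.
  by rewrite !clip_left//; lra.
- move=> x; have xs : x <= x + s by lra.
  (* The Steklov average over [[x, x + s]] equals the clipped function at some [z] there, and
     [s = d / 2] keeps [z] within the modulus [d]. *)
  have [|z] := MVT_segment xs (fun y _ => JD y).
    exact/continuous_subspaceT/(is_derive_continuous JD).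
  rewrite in_itv/= => /andP[xz zs] ->.
  rewrite (_ : s^-1 * _ = C z); last by field.
  rewrite (le_trans (ler_distD (C x) _ _))//.
  have := HM x; rewrite -/(C x).
  have cM : - M <= clip M x <= M.
    by rewrite /clip ge_max le_max lexx/= ge_min lexx orbT andbT; lra.
  have := Hd (clip M x) (clip M z) cM; rewrite -/(C x) -/(C z).
  have : `|clip M x - clip M z| < d.
    rewrite (le_lt_trans (clip_lipschitz _ _ _))// distrC ger0_norm; rewrite /s in s0 xs zs *; lra.
  by move=> h1 /(_ h1); lra.
Qed.

Lemma L1w_dense tau T e : 0 < tau -> Actau tau T -> 0 < e ->
  exists f, L1w tau f /\ tnorm tau (distr_add T (distr_scale (-1) (distr_of_fun f))) < e.
Proof.
move=> t0 /(ActauP _ t0)[F wF TF] e0; have [cF F0 lF] := wF.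
have e4 : 0 < e / 4 by lra.
have [H [h [M [ch HD hM GH]]]] := smooth_approx lF e4.
set k := rate tau in wF lF GH.
(* The inverse weight makes [f omega = h], so the transform of the primitive of [f] is [H - H 0],
   the smooth approximant of the transform of [F] up to a constant. *)
pose f x := h x * gauss k x; exists f.
have Lf : L1w tau f by exact: (continuous_supp_L1w t0 ch hM).
split=> //; have wf := L1w_wprim t0 Lf.
have fP := is_primitive_oint (L1w_integrable_on_segments Lf).
have [cf f0 lf] := wf.
rewrite (tnormE t0 (wprim_lin (-1) wF wf) (is_primitive_lin (-1) cF cf TF fP)).
rewrite (gstieltjes_lin _ _ cF cf) -/k.
have cf' : continuous f by exact: continuous_pM ch (weight_cont (gauss_weight k)).
have PD x : is_derive x (1 : R) H (f x * gauss (- k) x).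
  rewrite /f -mulrA gaussD addrN /gauss mul0r expR0 mulr1; exact: HD.
have E x : gstieltjes (- k) (fun x => oint 0 x f) x = H x - H 0.
  have := gstieltjes_antideriv 0 x cf' (fun x => is_derive_oint x cf') PD.
  by rewrite (gstieltjes_at0 (- k) (fun x => oint 0 x f)) oint0 subr0.
rewrite (le_lt_trans _ (_ : e / 4 + e / 4 < e)) ?(le_trans _ (normB_dist_le GH))//; last lra.
rewrite le_eqVlt; apply/orP; left; apply/eqP; apply: normB_eq => x y.
by rewrite !E; ring.
Qed.

End WeightedL1.

(** * Translations *)

Section Translation.
Variable R : realType.
Local Notation mu := (@lebesgue_measure R).
Implicit Types (f g h P Q F G H S w dw phi psi : R -> R) (a b c d e x y K M tau r s : R).
Implicit Types (T U : (R -> R) -> R).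

Lemma is_derive_translate f df a x : (forall x, is_derive x (1 : R) f (df x)) ->
  is_derive x (1 : R) (fun x => f (x + a)) (df (x + a)).
Proof.
move=> fD; apply: (is_derive_eq (@is_derive_pcomp _ f (fun x => x + a) x _ _ (fD (x + a))
  (is_derive_pD (is_derive_pX x) (is_derive_p1 a x)))).
by rewrite addr0 mul1r.
Qed.

Lemma continuous_translate f a : continuous f -> continuous (fun x => f (x + a)).
Proof.
move=> cf; apply: continuous_pcomp => // x.
by apply: cvgD; [exact: cvg_id|exact: cvg_cst].
Qed.

Lemma weight_translate w dw a : weight w dw ->
  weight (fun x => w (x + a)) (fun x => dw (x + a)).
Proof.
by move=> [wD cw]; split=> [x|]; [exact: is_derive_translate|exact: continuous_translate].
Qed.

(** A change of variables. Only increments correspond, because translation moves the base point 0 of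
    the integrals. *)
Lemma stieltjes_translate w dw F a x y : weight w dw -> continuous F ->
  stieltjes w dw (fun x => F (x - a)) y - stieltjes w dw (fun x => F (x - a)) x =
  stieltjes (fun x => w (x + a)) (fun x => dw (x + a)) F (y - a)
  - stieltjes (fun x => w (x + a)) (fun x => dw (x + a)) F (x - a).
Proof.
move=> [wD cw] cF; rewrite /stieltjes.
have c1 := continuous_pM (continuous_translate (a := - a) cF) cw.
have c2 := continuous_pM cF (continuous_translate (a := a) cw).
have D2 z : is_derive z (1 : R) (fun z => oint 0 (z - a) (fun t => F t * dw (t + a)))
    (F (z - a) * dw z).
  by apply: (is_derive_eq (is_derive_translate (- a) z (fun z => is_derive_oint z c2))); rewrite subrK.
have := oint_increment x y c1 D2.
rewrite !subrK; lra.
Qed.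

Lemma dprim_translate F a phi : continuous F -> test_fun phi ->
  dprim F (fun x => phi (x + a)) = dprim (fun x => F (x - a)) phi.
Proof.
move=> cF tp; apply: (congr1 (fun z => - z)).
have pD x := test_fun_derive x tp; have cp := test_fun_cont1 tp.
rewrite (is_derive_derive1E (fun x => is_derive_translate a x pD)).
have [M M0 [_ HM]] := test_fun_supp tp.
have c1 := continuous_pM (continuous_translate (a := - a) cF) cp.
have c2 := continuous_pM cF (continuous_translate (a := a) cp).
have D2 z : is_derive z (1 : R)
    (fun z => oint 0 (z + a) (fun t => F (t - a) * (derive1 phi) t)) (F z * (derive1 phi) (z + a)).
  by apply: (is_derive_eq (is_derive_translate a z (fun z => is_derive_oint z c1))); rewrite addrK.
have MM : - M - a <= M - a by lra.
have s2 x : F x * (derive1 phi) (x + a) != 0 -> - M - a <= x <= M - a.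
  by rewrite mulf_eq0 negb_or => /andP[_ /HM]; lra.
rewrite (RintegralT_antideriv MM c2 s2 D2) !subrK.
by rewrite (RintegralT_oint M0 c1 (supp_mull HM)).
Qed.

(** Tends to 1 at +oo, so its primitive grows linearly, and is [O(exp (2 x))] at -oo. Multiplied by
    [exp (- x)] it is the derivative of [- (1 + exp x)^-1], which has limits at both ends. *)
Definition logistic2 x := (expR x / (1 + expR x)) ^+ 2.

Lemma logistic_derive x : is_derive x 1 (fun y => (1 + expR y)^-1)
  (- (expR x / (1 + expR x) ^+ 2)).
Proof.
have e0 : 1 + expR x != 0 by rewrite gt_eqF// addr_gt0// expR_gt0.
have D : is_derive x (1 : R) (fun y => 1 + expR y) (expR x).
  apply: (is_derive_eq (is_derive_pD (is_derive_p1 1 x) (is_derive_pexp (is_derive_pX x)))).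
  by rewrite add0r mul1r.
apply: (is_derive_eq (@is_deriveV R (fun y => 1 + expR y) x _ 1 e0 D)).
by rewrite /GRing.scale/= mulNr mulrC.
Qed.

Lemma logistic2_cont : continuous logistic2.
Proof.
have cE : continuous (fun x : R => expR x) by exact: continuous_expR.
have cV : continuous (fun x : R => (1 + expR x)^-1).
  exact: (is_derive_continuous logistic_derive).
have cQ := continuous_pM cE cV.
rewrite (_ : logistic2 = fun x => (expR x * (1 + expR x)^-1) * (expR x * (1 + expR x)^-1)).
  exact: (continuous_pM cQ cQ).
by apply/funext => x; rewrite /logistic2 expr2.
Qed.

Lemma logistic_osc c : 0 <= c -> osc_vanishes (fun x => - c * (1 + expR x)^-1).
Proof.
(* From [exp M >= 1 + M] this choice gives [c <= e exp M], which controls both tails; on the left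
   the limit [- c] is compared. *)
move=> c0 e e0; pose M := c / e; have M0 : 0 <= M by rewrite divr_ge0// ltW.
have gt1 x : 0 < 1 + expR x by rewrite addr_gt0// expR_gt0.
have ne0 x : 1 + expR x != 0 by rewrite gt_eqF.
have cM : c <= e * expR M.
  rewrite (le_trans (_ : c <= e * (1 + M)))//; last by rewrite ler_pM2l// expR_ge1Dx.
  rewrite mulrDr mulr1 /M mulrCA mulfV ?gt_eqF// mulr1; lra.
exists M => //; split=> x y Mx My.
- have B z : M <= z -> 0 <= c * (1 + expR z)^-1 <= e.
    move=> Mz; rewrite mulr_ge0 ?invr_ge0 ?(ltW (gt1 _))//= ler_pdivrMr//.
    rewrite (le_trans cM)// ler_pM2l// (le_trans (_ : _ <= expR z)) ?ler_expR//; lra.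
  have /andP[x1 x2] := B x Mx; have /andP[y1 y2] := B y My.
  by rewrite ler_norml; lra.
- have B z : z <= - M -> 0 <= c - c * (1 + expR z)^-1 <= e.
    move=> Mz; have -> : c - c * (1 + expR z)^-1 = c * expR z / (1 + expR z).
      by field; exact: ne0.
    rewrite divr_ge0 ?mulr_ge0 ?expR_ge0 ?(ltW (gt1 _))//= ler_pdivrMr//.
    have ez : c * expR z <= e.
      rewrite (le_trans (_ : _ <= c * expR (- M)))//; first by rewrite ler_wpM2l// ler_expR.
      by rewrite expRN ler_pdivrMr// expR_gt0.
    have := mulr_gt0 e0 (expR_gt0 z); lra.
  have /andP[x1 x2] := B x Mx; have /andP[y1 y2] := B y My.
  by rewrite ler_norml; lra.
Qed.

(* With [a = - 2 tau] the quotient [omega_tau x / omega_tau (x + a)] is a multiple of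
   [exp (- x)].  A function [H] of linear growth at +oo with [H' = O(exp (2 x))] at
   -oo is then the weighted primitive of the translate, while the primitive of the
   original distribution, with derivative a multiple of [exp (- x) H'], has limits. *)
Lemma Actau_not_translation_invariant tau : 0 < tau ->
  exists T a, Actau tau T /\ ~ Actau tau (distr_trans T a).
Proof.
move=> t0; set k := rate tau; have k0 : 0 < k by exact: rate_gt0.
(* Here [(- x^2 + (x - 2 tau)^2) / (4 tau) = tau - x]: the shift is chosen to make the exponential
   rate 1, and [C = exp tau] is the leftover constant. *)
pose a := - (2 * tau); pose C := expR tau.
have W1 := weight_translate a (gauss_weight (- k)).
have W2 := weight_translate a (gauss_weight k).
pose H x := oint 0 x logistic2.
have HD x : is_derive x (1 : R) H (logistic2 x) := is_derive_oint x logistic2_cont.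
have cH : continuous H := is_derive_continuous HD.
(* Built backwards from [H]: after translation by [a] the weight seen by [F] is
   [gauss (- k) (x + a)], which this definition undoes, so the translate has the unbounded [H] as
   transform up to a shift and a constant. *)
pose F := stieltjes (fun x => gauss k (x + a)) (fun x => dgauss k (x + a)) H.
have cF : continuous F by exact: stieltjes_cont.
have F0 : F 0 = 0 by rewrite /F stieltjes0 /H oint0 mul0r.
have FH : stieltjes (fun x => gauss (- k) (x + a)) (fun x => dgauss (- k) (x + a)) F = H.
  apply/funext => x; rewrite (stieltjes_comp x W1 W2 cH) -[RHS](stieltjes_one H x).
  congr stieltjes; apply/funext => y.
    by rewrite gaussD addNr /gauss mul0r expR0.
  by rewrite /dgauss; ring.
have gC x : gauss (- k) x * gauss k (x + a) = C * expR (- x).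
  rewrite /gauss -!expRD /C; congr expR; rewrite /k /rate /a; field.
  by rewrite gt_eqF.
pose P x := - C * (1 + expR x)^-1.
have PD x : is_derive x (1 : R) P (logistic2 x * (gauss (- k) x * gauss k (x + a))).
  apply: (is_derive_eq (is_derive_pZ (- C) (logistic_derive x))).
  rewrite gC /logistic2 expRN; field.
  by rewrite !gt_eqF ?addr_gt0 ?expR_gt0.
have oP : osc_vanishes P by apply: logistic_osc; exact: expR_ge0.
have wF : wprim k F.
  split; [exact: cF|exact: F0|split; first exact: gstieltjes_cont].
  have E x : gstieltjes (- k) F x = P x - P 0.
    rewrite /gstieltjes (stieltjes_comp x (gauss_weight (- k)) W2 cH).
    have W := weightM (gauss_weight (- k)) W2.
    have := stieltjes_antideriv 0 x W logistic2_cont HD PD.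
    by rewrite stieltjes0 /H oint0 mul0r subr0.
  move=> e /oP[M M0 [H1 H2]]; exists M => //; split=> x y Mx My; rewrite !E.
    by rewrite (_ : _ - _ = P x - P y); [exact: H1|ring].
  by rewrite (_ : _ - _ = P x - P y); [exact: H2|ring].
exists (dprim F), a; split; first by apply/(ActauP _ t0); exists F.
move=> /(ActauP _ t0)[G [cG G0 lG] TG].
have cFa := continuous_translate (a := - a) cF.
have TFa : is_primitive (distr_trans (dprim F) a) (fun x => F (x - a)).
  by move=> phi tp; exact: dprim_translate.
have GF : G = fun x => F (x - a) + (- F (0 - a)) * 1.
  apply/funext => x; have := is_primitive_unique cG cFa TG TFa x 0.
  by rewrite G0 mulr1 subr0.
have c1 : continuous (fun _ : R => 1 : R) by move=> x; exact: cvg_cst.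
have [K K0 HK] := has_limits_bounded lG.
have inc x : H (x - a) - H (0 - a) = gstieltjes (- k) G x - gstieltjes (- k) G 0.
  rewrite GF (gstieltjes_lin _ _ cFa c1) /=.
  have := stieltjes_translate a 0 x (gauss_weight (- k)) cF.
  rewrite FH -/(gstieltjes (- k) (fun x => F (x - a))) => <-.
  rewrite /gstieltjes !(stieltjes_cst _ _ (gauss_weight (- k))); ring.
have Hb x : `|H (x - a)| <= `|H (0 - a)| + K + K.
  have := inc x; have := HK x; have := HK 0.
  set u := gstieltjes _ _ _; set v := gstieltjes _ _ _ => v1 u1 E.
  have -> : H (x - a) = H (0 - a) + (v - u) by rewrite -E; ring.
  by have := ler_normD (H (0 - a)) (v - u); have := ler_normB v u; lra.
(* For [x >= 0] the logistic function is at least 1/2, so its square is at least 1/4. *)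
have grow x : 0 <= x -> x / 4 <= H x.
  move=> x0; have D y := is_derive_pB (HD y) (is_derive_pZ 4^-1 (is_derive_pX y)).
  have := is_derive_le D x0; rewrite /H oint0 mulr0 subr0 => L.
  suff : 0 <= oint 0 x logistic2 - 4^-1 * x by lra.
  apply: L => y y0 _; rewrite mulr1 subr_ge0 /logistic2.
  have e1 : 1 <= expR y by rewrite (le_trans _ (expR_ge1Dx y))//; lra.
  have h : 2^-1 <= expR y / (1 + expR y) by rewrite ler_pdivlMr; lra.
  have -> : 4^-1 = 2^-1 * 2^-1 :> R by rewrite -invfM; congr _^-1; ring.
  by rewrite expr2 ler_pM.
pose B := `|H (0 - a)| + K + K; have B0 : 0 <= B by rewrite !addr_ge0.
(* At [4 B + 4] the linear lower bound is [B + 1], which exceeds the upper bound [B]; adding [a]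
   compensates the shift. *)
have := Hb (4 * B + 4 + a); rewrite addrK -/B => HB.
have := grow (4 * B + 4); have := ler_norm (H (4 * B + 4)).
move=> + /(_ ltac:(lra)); lra.
Qed.

End Translation.

Theorem theorem5p2 (R : realType) (tau : R) (htau : 0 < tau) :
  (* (a) *)
  (banach_space (@eq (R -> R)) (fun _ => 0) (@fadd R) (@fscale R)
      (Bctau tau) (normBtau tau) /\
   isometrically_isomorphic
      (@eq (R -> R)) (@fadd R) (@fscale R) (Bctau tau) (normBtau tau)
      (@eq (R -> R)) (@fadd R) (@fscale R) (@Bc R) (@normB R)) /\
  (* (b) *)
  (banach_space (@distr_eq R) (@distr_zero R) (@distr_add R) (@distr_scale R)
      (Actau tau) (tnorm tau) /\
   isometrically_isomorphic
      (@distr_eq R) (@distr_add R) (@distr_scale R) (Actau tau) (tnorm tau)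
      (@distr_eq R) (@distr_add R) (@distr_scale R) (@Ac R) (@anorm R)) /\
  (* (c) *)
  (forall T : (R -> R) -> R, is_distr T ->
      (Actau tau T <-> Ac (distr_mulw T (omega tau)))) /\
  (* (d) *)
  (forall T : (R -> R) -> R, Actau tau T ->
      tnorm tau T = anorm (distr_mulw T (omega tau))) /\
  (* (e) *)
  ((forall T, Ac T -> Actau tau T) /\ (exists T, Actau tau T /\ ~ Ac T)) /\
  (* (f) *)
  (forall r s : R, 0 < r -> 0 < s ->
      (r < s <-> ((forall T, Actau s T -> Actau r T) /\
                  (exists T, Actau r T /\ ~ Actau s T)))) /\
  (* (g) *)
  (forall (T : (R -> R) -> R) (F : R -> R), Actau tau T ->
      Bctau tau F -> is_primitive T F ->
      (forall x : R, `|F x| <= tnorm tau T * expR (x ^+ 2 / (4 * tau))) /\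
      (F x / expR (x ^+ 2 / (4 * tau)) @[x --> +oo] --> 0) /\
      (F x / expR (x ^+ 2 / (4 * tau)) @[x --> -oo] --> 0)) /\
  (* (h) *)
  (forall r s : R, 0 < r -> r < s ->
      (forall T, Actau s T -> Actau r T) /\
      (forall T U, Actau s T -> Actau s U -> Actau s (distr_add T U)) /\
      (forall (a : R) T, Actau s T -> Actau s (distr_scale a T)) /\
      (forall T, Actau r T -> forall e : R, 0 < e ->
         exists U, Actau s U /\ tnorm r (distr_add T (distr_scale (-1) U)) < e)) /\
  (* (i) *)
  (forall r s : R, 0 < r -> r < s ->
      forall T, Actau s T -> tnorm r T <= 2 * tnorm s T) /\
  (* (j) *)
  ((forall f : R -> R, L1w tau f -> Actau tau (distr_of_fun f)) /\
   (forall T, Actau tau T -> forall e : R, 0 < e ->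
      exists f : R -> R, L1w tau f /\ tnorm tau (distr_add T (distr_scale (-1) (distr_of_fun f))) < e)) /\
  (* (k) *)
  (exists (T : (R -> R) -> R) (a : R), Actau tau T /\ ~ Actau tau (distr_trans T a)).
Proof.
have I r s : 0 < r -> r < s -> forall T, Actau s T -> Actau r T.
  by move=> r0 rs T; exact: Actau_le r0 (ltW rs).
split; first by split; [exact: Bctau_banach|exact: Bctau_isometry].
split; first by split; [exact: Actau_banach|exact: Actau_isometry].
split; first by move=> T dT; exact: distr_mulw_Ac.
split; first by move=> T; exact: tnorm_anorm.
split; first by split; [move=> T; exact: Ac_Actau|exact: Actau_strict_Ac].
split; first exact: Actau_strict_iff.
split; first by move=> T F _; exact: Bctau_growth.
split.
  move=> r s r0 rs; have s0 := lt_trans r0 rs.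
  split; first exact: I r0 rs.
  split; first by move=> T U; exact: Actau_add.
  split; first by move=> a T; exact: Actau_scale.
  by move=> T rT e e0; exact: Actau_dense r0 rs rT e0.
split; first by move=> r s r0 rs T; exact: tnorm_le.
split; last exact: Actau_not_translation_invariant.
split; first by move=> f; exact: L1w_Actau.
by move=> T aT e e0; exact: L1w_dense.
Qed.
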